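(* Let $W$ be of type $H_3$. For every positive integer $t$ the $q$-Kreweras numbers $\mathrm{Krew}(W,\chi,t;q)$ and the graded multiplicities $\langle Q_\chi,V\rangle$ of the reflection representation are as follows, where $[k]=(q^k-1)/(q-1)$: - $\phi_{1,15}$: $\mathrm{Krew}=\dfrac{[t-1][t-5][t-9]}{[2][6][10]}$, $\langle Q,V\rangle=q^9+q^5+q$; - $\phi_{1,0}$: $\mathrm{Krew}=q^{3t-3}$, $\langle Q,V\rangle=0$; - $\phi_{5,5}$: $\mathrm{Krew}=q^{2t-10}\dfrac{[t-1]}{[2]}$, $\langle Q,V\rangle=q$; - $\phi_{5,2}$: $\mathrm{Krew}=q^{2t-6}(q-1)[t-1]$, $\langle Q,V\rangle=q$; - $\phi_{3,6}$: $\mathrm{Krew}=q^{t-7}(q-1)\dfrac{[t-1][t-5]}{[2]}$, $\langle Q,V\rangle=q^5+q$; - $\phi_{3,8}$: $\mathrm{Krew}=q^{t-9}\dfrac{[t-1][t-5]}{[2]^2}$, $\langle Q,V\rangle=q^5+q$; - $\phi_{3,1}$: $\mathrm{Krew}=q^{2t-4}(q-1)[t-1]$, $\langle Q,V\rangle=q$; - $\phi_{3,3}$: $\mathrm{Krew}=q^{2t-6}\dfrac{[t-1]}{[2]}$, $\langle Q,V\rangle=q$; - $\phi_{4,3}$: $\mathrm{Krew}=q^{2t-8}(q-1)[t-1]$, $\langle Q,V\rangle=q$; - $\phi_{4,4}$: $\mathrm{Krew}=q^{2t-8}\dfrac{[t-1]}{[2]}$, $\langle Q,V\rangle=q$.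
   Context: $W$ is the Coxeter group of type $H_3$, $V$ its (complexified) 3-dimensional reflection representation, $\mathrm{sgn}=\wedge^3V$; it has $15$ reflections. The fake degree $b(\chi)$ of $\chi\in\mathrm{Irr}(W)$ is the smallest $i$ such that $\chi$ occurs in $S^i(V)$. $\phi_{d,e}$ is the unique irreducible representation of dimension $d$ and fake degree $e$; $\mathrm{Irr}(W)=\{\phi_{1,0},\phi_{3,1},\phi_{5,2},\phi_{4,3},\phi_{3,3},\phi_{4,4},\phi_{5,5},\phi_{3,6},\phi_{3,8},\phi_{1,15}\}$. **Green functions.** $\mathcal K(W)$ is the Grothendieck group, $\langle\cdot,\cdot\rangle$ the $\mathbb Q(q)$-bilinear form on $\mathcal K(W)_{\mathbb Q(q)}$ with $\mathrm{Irr}(W)$ orthonormal, $C(q)$ the coinvariant algebra of $W$ graded by $q$. Use the total order $\phi_{1,0}>_p\phi_{3,1}>_p\phi_{5,2}>_p\phi_{4,3}>_p\phi_{3,3}>_p\phi_{4,4}>_p\phi_{5,5}>_p\phi_{3,6}>_p\phi_{3,8}>_p\phi_{1,15}$. The Lusztig–Shoji algorithm produces unique $Q_\chi\in\mathcal K(W)_{\mathbb Q(q)}$ and nonzero $\lambda_\chi\in\mathbb Q(q)$ with $\langle Q_\chi,\chi\rangle=q^{b(\chi)}$, $\langle Q_\chi,\varphi\rangle=0$ unless $\varphi\ge_p\chi$, and $q^{15}\langle C(q)\otimes\varphi\otimes\mathrm{sgn},\psi\rangle=\sum_\chi\lambda_\chi\langle Q_\chi,\varphi\rangle\langle Q_\chi,\psi\rangle$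 for all $\varphi,\psi\in\mathrm{Irr}(W)$. $\{Q_\chi\}$ is a basis of $\mathcal K(W)_{\mathbb Q(q)}$. **$q$-Kreweras numbers.** With $S^*(V)=\bigoplus_iS^i(V)q^i$, let $\mathcal H_t=\sum_{i=0}^3(-q^t)^iS^*(V)\otimes\wedge^iV\in\mathcal K(W)_{\mathbb Q(q)}$; $\mathrm{Krew}(W,\chi,t;q)\in\mathbb Q(q)$ is defined by $\mathcal H_t=\sum_\chi\mathrm{Krew}(W,\chi,t;q)Q_\chi$. *)

(* Defs.v *)
From Stdlib Require Import ClassicalEpsilon.
From mathcomp Require Import all_boot all_order all_algebra.
From mathcomp Require Import all_fingroup all_solvable all_field all_character.
From mathcomp Require Import mpoly.

Set Implicit Arguments.
Unset Strict Implicit.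
Unset Printing Implicit Defensive.

Import Order.TTheory GRing.Theory Num.Theory.
Local Open Scope ring_scope.

Section Monomials.

Variable d : nat.

Definition monom n := {m : 'X_{1..d < n.+1} | mdeg m == n}.

Definition sdim n := #|{: monom n}|.

Definition mon n (i : 'I_(sdim n)) : 'X_{1..d} := val (enum_val i : monom n).

Lemma mdeg_mon n (i : 'I_(sdim n)) : mdeg (mon i) = n.
Proof. exact/eqP/(valP (enum_val i : monom n)). Qed.

Lemma mon_inj n : injective (@mon n).
Proof. by move=> i j /val_inj /val_inj /enum_val_inj. Qed.

Lemma mon_surj n (m : 'X_{1..d}) : mdeg m = n -> exists i : 'I_(sdim n), mon i = m.
Proof.
move=> dm; have lt_m : (mdeg m < n.+1)%N by rewrite dm.
have Hm : mdeg (BMultinom lt_m) == n by rewrite /= dm.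
by exists (enum_rank (Sub (BMultinom lt_m) Hm : monom n)); rewrite /mon enum_rankK.
Qed.

End Monomials.

Section SymmetricPower.

Variables (F : fieldType) (d : nat).

Definition hpoly n (v : 'rV[F]_(sdim d n)) : {mpoly F[d]} :=
  \sum_i v 0 i *: 'X_[mon i].

Definition hcoef n (p : {mpoly F[d]}) : 'rV[F]_(sdim d n) :=
  \row_i p@_(mon i).

(* The algebra endomorphism of S(V) = F[X_0, ..., X_(d-1)] induced by
   v |-> v *m A on V; the variable X_i stands for the i-th basis vector,
   whose image is the i-th row of A. *)
Definition lsubst (A : 'M[F]_d) (p : {mpoly F[d]}) : {mpoly F[d]} :=
  p \mPo [tuple \sum_j A i j *: 'X_j | i < d].

Definition sym_mx n (A : 'M[F]_d) : 'M[F]_(sdim d n) :=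
  \matrix_i hcoef n (lsubst A 'X_[mon i]).

Implicit Types (A B : 'M[F]_d).

Lemma lsubstZ A c (p : {mpoly F[d]}) : lsubst A (c *: p) = c *: lsubst A p.
Proof. exact: comp_mpolyZ. Qed.

Lemma lsubst_sum A (I : finType) (f : I -> {mpoly F[d]}) :
  lsubst A (\sum_i f i) = \sum_i lsubst A (f i).
Proof. exact: raddf_sum. Qed.

Lemma lsubstM A (p q : {mpoly F[d]}) : lsubst A (p * q) = lsubst A p * lsubst A q.
Proof. exact: rmorphM. Qed.

Lemma lsubstXU A i : lsubst A 'X_i = \sum_j A i j *: 'X_j.
Proof. by rewrite /lsubst comp_mpolyXU -tnth_nth tnth_mktuple. Qed.

Lemma lsubst_comp A B (p : {mpoly F[d]}) : lsubst B (lsubst A p) = lsubst (A *m B) p.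
Proof.
rewrite /lsubst !(comp_mpolyEX p) raddf_sum /=.
apply: eq_bigr => m _; rewrite !comp_mpolyZ; congr (_ *: _).
rewrite !comp_mpolyX rmorph_prod /=; apply: eq_bigr => i _.
rewrite rmorphXn /= !tnth_mktuple; congr (_ ^+ _).
rewrite raddf_sum /=.
under eq_bigr => j _ do
  rewrite comp_mpolyZ comp_mpolyXU -tnth_nth tnth_mktuple scaler_sumr.
rewrite exchange_big /=; apply: eq_bigr => k _.
rewrite mxE scaler_suml; apply: eq_bigr => j _; by rewrite scalerA.
Qed.

Lemma lsubst1 (p : {mpoly F[d]}) : lsubst 1%:M p = p.
Proof.
rewrite -[RHS]comp_mpoly_id /lsubst; congr (comp_mpoly _ _).
apply: eq_from_tnth => i; rewrite !tnth_mktuple (bigD1 i) //= big1 ?addr0.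
  by rewrite mxE eqxx scale1r.
by move=> j /negPf ji; rewrite mxE eq_sym ji scale0r.
Qed.

Lemma lsubst_homog A n (p : {mpoly F[d]}) : p \is n.-homog -> lsubst A p \is n.-homog.
Proof.
move=> hp; rewrite /lsubst comp_mpolyE; rewrite big_seq; apply: rpred_sum => m mp.
have dm : mdeg m = n by apply: (dhomogP _ _ _ hp).
apply: rpredZ; rewrite -dm mdegE.
elim/big_rec2: _ => [|i k q _ hq]; first exact: dhomog1.
apply: dhomogM => //; rewrite -[X in X.-homog]mul1n; apply: dhomogMn.
rewrite tnth_mktuple; apply: rpred_sum => j _; apply: rpredZ.
by rewrite dhomogX; apply/eqP; rewrite /= mdeg1.
Qed.

Lemma hpolyK n : cancel (@hpoly n) (@hcoef n).
Proof.
move=> v; apply/rowP=> i; rewrite mxE /hpoly raddf_sum /= (bigD1 i) //= big1.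
  by rewrite addr0 mcoeffZ mcoeffX eqxx mulr1.
move=> j /negPf ji; rewrite mcoeffZ mcoeffX; case: eqP => [/mon_inj /eqP|]; first by rewrite ji.
by rewrite mulr0.
Qed.

Lemma hcoefK n (p : {mpoly F[d]}) : p \is n.-homog -> hpoly (hcoef n p) = p.
Proof.
move=> hp; apply/mpolyP=> m; rewrite /hpoly raddf_sum /=.
have [dm|dm] := eqVneq (mdeg m) n.
  have [i <-] := mon_surj dm; rewrite (bigD1 i) //= big1.
    by rewrite addr0 mcoeffZ mcoeffX eqxx mulr1 mxE.
  move=> j /negPf ji; rewrite mcoeffZ mcoeffX; case: eqP => [/mon_inj /eqP|]; first by rewrite ji.
  by rewrite mulr0.
rewrite (dhomog_nemf_coeff hp dm) big1 // => i _; rewrite mcoeffZ mcoeffX.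
case: eqP => [e|]; last by rewrite mulr0.
by rewrite -e mdeg_mon eqxx in dm.
Qed.

Lemma hpoly_homog n (v : 'rV[F]_(sdim d n)) : hpoly v \is n.-homog.
Proof.
by apply: rpred_sum => i _; apply: rpredZ; rewrite dhomogX; apply/eqP/mdeg_mon.
Qed.

Lemma hcoefZ n c (p : {mpoly F[d]}) : hcoef n (c *: p) = c *: hcoef n p.
Proof. by apply/rowP=> i; rewrite !mxE mcoeffZ. Qed.

Lemma hcoef_sum n (I : finType) (f : I -> {mpoly F[d]}) :
  hcoef n (\sum_i f i) = \sum_i hcoef n (f i).
Proof.
apply/rowP=> i; rewrite summxE mxE raddf_sum /=.
by apply: eq_bigr => j _; rewrite mxE.
Qed.

Lemma mul_sym_mx n A (v : 'rV_(sdim d n)) : v *m sym_mx n A = hcoef n (lsubst A (hpoly v)).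
Proof.
rewrite mulmx_sum_row /hpoly lsubst_sum hcoef_sum.
apply: eq_bigr => i _.
by rewrite lsubstZ hcoefZ rowK.
Qed.

Lemma sym_mx1 n : sym_mx n (1%:M : 'M[F]_d) = 1%:M.
Proof.
apply/row_matrixP=> i; rewrite !rowE mul_sym_mx lsubst1 hpolyK.
by rewrite mulmx1.
Qed.

Lemma sym_mxM n A B : sym_mx n (A *m B) = sym_mx n A *m sym_mx n B.
Proof.
apply/row_matrixP=> i; rewrite !rowE mulmxA !mul_sym_mx hcoefK ?lsubst_comp //.
exact/lsubst_homog/hpoly_homog.
Qed.

End SymmetricPower.

Section ExteriorPower.

Variables (F : fieldType) (d k : nat).

Definition incr := {t : k.-tuple 'I_d | sorted ltn [seq val i | i <- t]}.

Definition edim := #|{: incr}|.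

Definition inc (i : 'I_edim) : 'I_k -> 'I_d :=
  tnth (val (enum_val i : incr)).

(* In the basis e_(t_0) /\ ... /\ e_(t_(k-1)), t increasing, of the k-th
   exterior power, an endomorphism acts by its k x k minors. *)
Definition ext_mx (A : 'M[F]_d) : 'M[F]_edim :=
  \matrix_(i, j) \det (mxsub (inc i) (inc j) A).

Lemma incr_uniq (t : incr) : uniq (val t).
Proof.
rewrite -(map_inj_uniq val_inj); apply: sorted_uniq (valP t).
  exact: ltn_trans.
by move=> x; rewrite /= ltnn.
Qed.

Lemma incr_perm_inj (t u : incr) : perm_eq (val t) (val u) -> t = u.
Proof.
move=> tu; apply/val_inj/val_inj/(inj_map val_inj) => /=.
apply: (sorted_eq (leT := ltn)); [exact: ltn_trans | | exact: (valP t) | exact: (valP u) | ].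
  by move=> x y /andP[xy yx]; move: (ltn_trans xy yx); rewrite ltnn.
exact: perm_map.
Qed.

Definition pmul (p : incr * 'S_k) : k.-tuple 'I_d :=
  [tuple tnth (val p.1) (p.2 i) | i < k].

Lemma pmul_inj : injective pmul.
Proof.
move=> [t s] [u s'] E; have tu : t = u.
  apply: incr_perm_inj.
  have h (p : incr * 'S_k) : perm_eq (pmul p) (val p.1).
    by apply/tuple_permP; exists p.2.
  apply: perm_trans (h (u, s')); rewrite -E perm_sym; exact: h (t, s).
congr (_, _) => //; apply/permP=> i; rewrite -{u}tu in E.
have := congr1 (fun x => tnth x i) E; rewrite !tnth_mktuple /=.
by move/(tuple_uniqP _ (incr_uniq t)).
Qed.

Lemma pmul_codom : [set pmul p | p : incr * 'S_k] = [set g : k.-tuple 'I_d | uniq g].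
Proof.
apply/setP=> g; rewrite inE; apply/imsetP/idP => [[p _ ->]|ug].
  have hp : perm_eq (pmul p) (val p.1) by apply/tuple_permP; exists p.2.
  by rewrite (perm_uniq hp) incr_uniq.
pose t := sort_tuple (relpre val leq) g.
have st : sorted ltn [seq val i | i <- t].
  rewrite ltn_sorted_uniq_leq (map_inj_uniq val_inj) sort_uniq ug /=.
  rewrite sorted_map; apply: sort_sorted => x y; exact: leq_total.
have /tuple_permP[s es] : perm_eq g t by rewrite perm_sym perm_sort.
exists (exist _ t st, s) => //.
exact/val_inj/es.
Qed.

Lemma det_sum_row (B : 'M[F]_(d, k)) (A : 'M[F]_(k, d)) :
  \det (A *m B) = \sum_(g : k.-tuple 'I_d) (\prod_i A i (tnth g i)) * \det (rowsub (tnth g) B).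
Proof.
rewrite /determinant.
under [RHS]eq_bigr => g _ do rewrite mulr_sumr.
rewrite exchange_big /=; apply: eq_bigr => s _.
under eq_bigr => i _ do rewrite mxE.
rewrite bigA_distr_bigA /= mulr_sumr.
pose T2f (t : k.-tuple 'I_d) : {ffun 'I_k -> 'I_d} := [ffun i => tnth t i].
pose f2T (f : {ffun 'I_k -> 'I_d}) : k.-tuple 'I_d := [tuple f i | i < k].
rewrite (reindex T2f) /=; last first.
  exists f2T => [t _ | f _]; first by apply: eq_from_tnth => i; rewrite tnth_mktuple ffunE.
  by apply/ffunP => i; rewrite ffunE tnth_mktuple.
apply: eq_bigr => t _; rewrite big_split /= mulrCA; congr (_ * (_ * _)).
  by apply: eq_bigr => i _; rewrite ffunE.
by apply: eq_bigr => i _; rewrite ffunE !mxE.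
Qed.

Lemma cauchy_binet (A : 'M[F]_(k, d)) (B : 'M[F]_(d, k)) :
  \det (A *m B) =
  \sum_(t : incr) \det (colsub (tnth (val t)) A) * \det (rowsub (tnth (val t)) B).
Proof.
rewrite det_sum_row (bigID (fun g : k.-tuple 'I_d => uniq g)) /= [X in _ + X]big1 ?addr0; last first.
  move=> g Ug; have [i [j [ij eij]]] : exists i j, i != j /\ tnth g i = tnth g j.
    case: (boolP [exists i, exists j, (i != j) && (tnth g i == tnth g j)]).
      by case/existsP=> i /existsP[j /andP[ij /eqP eij]]; exists i, j.
    move=> H; case/negP: Ug; apply/tuple_uniqP => i j eij; apply/eqP.
    apply: contraT => ij; case/negP: H; apply/existsP; exists i.
    by apply/existsP; exists j; rewrite ij eij eqxx.
  rewrite (determinant_alternate ij) ?mulr0 // => x.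
  by rewrite !mxE eij.
rewrite (eq_bigl (fun g => g \in [set g : k.-tuple 'I_d | uniq g])); last by move=> g; rewrite /= inE.
rewrite -pmul_codom big_imset /=; last by move=> x y _ _; exact: pmul_inj.
rewrite (eq_bigl xpredT); last by move=> [].
rewrite -(pair_bigA _ (fun t s => (\prod_i A i (tnth (pmul (t, s)) i)) *
   \det (rowsub (tnth (pmul (t, s))) B))) /=.
apply: eq_bigr => t _; rewrite [\det (colsub _ _)]/determinant mulr_suml.
apply: eq_bigr => s _.
have -> : rowsub (tnth (pmul (t, s))) B = row_perm s (rowsub (tnth (val t)) B).
  by apply/matrixP=> i j; rewrite !mxE tnth_mktuple.
rewrite row_permE det_mulmx det_perm mulrA -[_ * (-1) ^+ s]mulrC.
congr (_ * _ * _); apply: eq_bigr => i _; by rewrite !mxE tnth_mktuple.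
Qed.

Lemma ext_mx1 : ext_mx (1%:M : 'M[F]_d) = 1%:M.
Proof.
apply/matrixP=> i j; rewrite !mxE; have [<-|ij] := eqVneq i j.
  rewrite (_ : mxsub _ _ _ = 1%:M) ?det1 //.
  apply/matrixP=> a b; rewrite !mxE (inj_eq (tuple_uniqP _ (incr_uniq _))) //.
have : exists a, inc i a \notin val (enum_val j : incr).
  apply/existsP; apply: contraT; rewrite negb_exists => /forallP H.
  case/eqP: ij; apply/enum_val_inj/incr_perm_inj/uniq_perm; try exact: incr_uniq.
  have sub : {subset val (enum_val i : incr) <= val (enum_val j : incr)}.
    by move=> x /tnthP[a ->]; have := H a; rewrite negbK.
  by apply: (uniq_min_size (incr_uniq _) sub _).2; rewrite !size_tuple.
case=> a Ha; rewrite (expand_det_row _ a) big1 // => b _; rewrite !mxE.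
case: eqP => [e|]; last by rewrite mul0r.
by move: Ha; rewrite e mem_tnth.
Qed.

Lemma ext_mxM (A B : 'M[F]_d) : ext_mx (A *m B) = ext_mx A *m ext_mx B.
Proof.
apply/matrixP=> i j; rewrite !mxE mxsub_mul cauchy_binet.
rewrite (reindex (@enum_val _ {: incr})) /=; last first.
  exact/onW_bij/enum_val_bij.
apply: eq_bigr => t _; rewrite !mxE; congr (_ * _); congr (\det _);
  by apply/matrixP=> a b; rewrite !mxE.
Qed.
End ExteriorPower.

Section Representations.

Variables (F : fieldType) (gT : finGroupType) (G : {group gT}) (d : nat).
Variable rG : mx_representation F G d.

Lemma sym_mx_repr n : mx_repr G (fun x => sym_mx n (rG x)).
Proof.
split=> [|x y Gx Gy]; first by rewrite repr_mx1 sym_mx1.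
by rewrite repr_mxM // sym_mxM.
Qed.

Definition sym_repr n := MxRepresentation (sym_mx_repr n).

Lemma ext_mx_repr k : mx_repr G (fun x => ext_mx k (rG x)).
Proof.
split=> [|x y Gx Gy]; first by rewrite repr_mx1 ext_mx1.
by rewrite repr_mxM // ext_mxM.
Qed.

Definition ext_repr k := MxRepresentation (ext_mx_repr k).

(* The row space of this matrix is the degree n component of the ideal of S(V)
   generated by the invariants of positive degree: it is spanned by the products
   f * m, with f running over a spanning set of the invariants of degree k,
   0 < k <= n, and m over the monomials of degree n - k. *)
Definition coinv_ideal n : 'M[F]_(sdim d n) :=
  (\sum_(k < n.+1 | (0 < k)%N)
     \sum_(r < sdim d k) \sum_(j < sdim d (n - k))
       <<hcoef n (hpoly (row r (rfix_mx (sym_repr k) G)) * 'X_[mon j])>>)%MS.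

Lemma coinv_ideal_module n : mxmodule (sym_repr n) (coinv_ideal n).
Proof.
apply: sumsmx_module => k _; apply: sumsmx_module => r _.
apply/mxmoduleP=> x Gx; rewrite sumsmxMr; apply/sumsmx_subP=> j _.
rewrite (eqmxMr _ (genmxE _)) /= mul_sym_mx.
have le_kn : (k <= n)%N by rewrite -ltnS.
set f := hpoly (row _ _).
have fh : f \is k.-homog by exact: hpoly_homog.
have mh : 'X_[F, mon j] \is (n - k).-homog.
  by rewrite dhomogX; apply/eqP/mdeg_mon.
have fmh : f * 'X_[F, mon j] \is n.-homog.
  by have := dhomogM fh mh; rewrite (subnKC le_kn).
rewrite (hcoefK fmh).
have fx : lsubst (rG x) f = f.
  rewrite -(hcoefK (lsubst_homog (rG x) fh)) -mul_sym_mx; congr hpoly.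
  by rewrite -row_mul -[sym_mx k _]/(sym_repr k x) rfix_mx_id.
rewrite lsubstM fx -(hcoefK (lsubst_homog (rG x) mh)) /hpoly mulr_sumr hcoef_sum.
apply: summx_sub => i _; rewrite -scalerAr hcoefZ scalemx_sub //.
by apply: (sumsmx_sup i) => //; rewrite genmxE.
Qed.

Definition coinv_repr n := factmod_repr (coinv_ideal_module n).

End Representations.

Notation Qq := {fraction {poly rat}}.

Definition q : Qq := tofrac 'X.

Definition qint (k : int) : Qq := (q ^ k - 1) / (q - 1).

Definition expands (f : Qq) (a : nat -> rat) : Prop :=
  exists u v : {poly rat},
    [/\ v`_0 != 0, f = tofrac u / tofrac v
      & forall n, u`_n = \sum_(i < n.+1) v`_i * a (n - i)%N].

(* The rational function with power series expansion \sum_n a_n q^n; it is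
   unique when it exists. *)
Definition gsum (a : nat -> rat) : Qq :=
  epsilon (inhabits 0) (fun f => expands f a).

(* The universal property says that W is presented by the generators s i and
   the relations (s i * s j) ^+ m i j = 1. *)
Definition coxeter_system (I : finType) (m : I -> I -> nat)
    (gT : finGroupType) (W : {group gT}) (s : I -> gT) : Prop :=
  [/\ W :=: <<[set s i | i : I]>>%g,
      forall i j, ((s i * s j) ^+ m i j = 1)%g
    & forall (hT : groupType) (f : I -> hT),
        (forall i j, ((f i * f j) ^+ m i j = 1)%g) ->
        exists2 g : gT -> hT,
          {in W &, {morph g : x y / (x * y)%g}} & forall i, g (s i) = f i].

(* The diagram s 0 -5- s 1 -3- s 2. *)
Definition H3_matrix (i j : 'I_3) : nat :=
  nth 0%N (nth [::] [:: [:: 1; 5; 2]; [:: 5; 1; 3]; [:: 2; 3; 1]]%N i) j.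

(* cos (pi / m), as m.-root (-1) is exp (i pi / m) *)
Definition cospi (m : nat) : algC := 'Re (m.-root (-1)).

(* The matrix, acting on row vectors in the basis of simple roots, of
   alpha_j |-> alpha_j + 2 cos (pi / m i j) alpha_i. *)
Definition simple_refl d (m : 'I_d -> 'I_d -> nat) (i : 'I_d) : 'M[algC]_d :=
  \matrix_(j, k) ((k == j)%:R + 2 * cospi (m i j) * (k == i)%:R).

Definition geometric_repr d (m : 'I_d -> 'I_d -> nat)
    (gT : finGroupType) (W : {group gT}) (s : 'I_d -> gT)
    (V : mx_representation algC W d) : Prop :=
  forall i, V (s i) = simple_refl m i.

Section Grothendieck.

Variables (gT : finGroupType) (W : {group gT}).

(* K(W) with scalars extended to Q(q): an element is given by its coordinates
   in the basis Irr(W). *)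
Definition Kq := {ffun Iirr W -> Qq^o}.

Definition pairing (x y : Kq) : Qq := \sum_i x i * y i.

(* phi is a character, so '[phi, 'chi_i] is a natural number. *)
Definition mult (phi : 'CF(W)) (i : Iirr W) : rat :=
  (Num.truncn '[phi, 'chi_i])%:R.

(* The class of a graded character, phi n sitting in degree n. *)
Definition gclass (phi : nat -> 'CF(W)) : Kq :=
  [ffun i => gsum (fun n => mult (phi n) i)].

Definition kclass (phi : 'CF(W)) : Kq := [ffun i => tofrac (mult phi i)%:P].

Variables (d : nat) (V : mx_representation algC W d).

Definition symC n : 'CF(W) := cfRepr (sym_repr V n).
Definition extC k : 'CF(W) := cfRepr (ext_repr V k).
Definition coinvC n : 'CF(W) := cfRepr (coinv_repr V n).
Definition sgnC : 'CF(W) := extC d.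

Definition is_fake_degree (i : Iirr W) (e : nat) : bool :=
  (i \in irr_constt (symC e)) && [forall k : 'I_e, i \notin irr_constt (symC k)].

(* The irreducible character of dimension n and fake degree e (junk value 'chi_0
   if there is none). *)
Definition phi (n e : nat) : Iirr W :=
  odflt 0 [pick i | ('chi[W]_i 1%g == n%:R) && is_fake_degree i e].

(* The total order on Irr(W) is given by the list of its elements in decreasing
   order. *)
Definition gep (s : seq (Iirr W)) (x y : Iirr W) : bool :=
  (index x s <= index y s)%N.

Definition lusztig_shoji (s : seq (Iirr W)) (N : nat)
    (Q : Iirr W -> Kq) (lambda : Iirr W -> Qq) : Prop :=
  [/\ forall x, lambda x != 0,
      forall x e, is_fake_degree x e -> pairing (Q x) (kclass 'chi_x) = q ^+ e,
      forall x y, ~~ gep s y x -> pairing (Q x) (kclass 'chi_y) = 0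
    & forall x y,
        q ^+ N * pairing (gclass (fun n => coinvC n * 'chi_x * sgnC))
                         (kclass 'chi_y) =
        \sum_z lambda z * pairing (Q z) (kclass 'chi_x)
                        * pairing (Q z) (kclass 'chi_y)].

Definition Ht (t : nat) : Kq :=
  \sum_(i < d.+1) (- q ^+ t) ^+ i *: gclass (fun n => symC n * extC i).

Definition q_kreweras (Q : Iirr W -> Kq) (t : nat) (Krew : Iirr W -> Qq) : Prop :=
  Ht t = \sum_x Krew x *: Q x.

End Grothendieck.

Definition H3_order (gT : finGroupType) (W : {group gT})
    (V : mx_representation algC W 3) : seq (Iirr W) :=
  [:: phi V 1 0; phi V 3 1; phi V 5 2; phi V 4 3; phi V 3 3;
      phi V 4 4; phi V 5 5; phi V 3 6; phi V 3 8; phi V 1 15].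

(* Main.v *)
Require Import Defs.
From Stdlib Require Import ZArith.
From mathcomp Require Import all_boot all_order all_algebra.
From mathcomp Require Import all_fingroup all_solvable all_field all_character.
From mathcomp Require Import mpoly.
From mathcomp Require Import ring ssrZ.

Set Implicit Arguments.
Unset Strict Implicit.
Unset Printing Implicit Defensive.

Import Order.TTheory GRing.Theory Num.Theory.
Local Open Scope ring_scope.
Local Delimit Scope Z_scope with coqZ.

(** The statement is a comparison of two explicit computations in Q(q), once the
    graded characters of the symmetric and coinvariant algebras are known on the
    ten conjugacy classes of W.

    The group. A rewriting system derived from the Coxeter relations brings every
    word in the generators to one of 120 normal forms ([W_wordsP]). Over Z[tau],
    tau = 2 cos (pi / 5), these have 120 distinct matrices in V, so W has exactly
    120 elements ([W_enum], [card_W]) and V is faithful. Only the equation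
    tau ^ 2 = tau + 1 enters: the other root would merely exchange V with its
    Galois conjugate. Trace and determinant in V take ten joint values on W, and
    every class function below depends on them only; it is stored as a list of
    ten elements of Z[tau], and inner products become finite computations
    ([cfdot_table]).

    The coinvariant algebra. Its definition as a quotient gives no character at
    once. Chevalley's lemma ([chevalley]), proved with divided differences, shows
    that S(V) is free over the invariants, so that the character of S ^ n V is a
    convolution of the Hilbert series of the invariants with the graded character
    of the coinvariants ([sym_char]). No basic invariants are exhibited: Molien's
    formula ([molien_coef]) gives the Hilbert series of the invariants
    ([inv_dim_series]) and, as det (1 - q w) divides
    D = (1 - q ^ 2) (1 - q ^ 6) (1 - q ^ 10) for each w, the value of the graded
    coinvariant character at w is the polynomial D / det (1 - q w)
    ([coinv_table]).

    The characters. The representation V, its Galois conjugate, the degree 2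
    coinvariants, the degree 3 coinvariants minus the conjugate of V, the trivial
    character, and their twists by the sign are virtual characters of norm 1 and
    positive degree, hence irreducible ([irr_table]); their degrees have squares
    adding up to 120, so there are no others ([rho_onto]). The lowest degree in
    which each occurs in the coinvariants is its fake degree ([fake_degreeP]),
    which identifies the characters named in the statement ([phi_rho]).

    The conclusion. The Lusztig-Shoji equations say that a symmetric matrix is
    factored through a triangular one with prescribed diagonal; such a
    factorization is unique ([gram_unique]), so it is enough to exhibit one with
    polynomial entries ([greenE]). The Krew coefficients then solve a triangular
    system ([triangular_solve]), and the announced closed forms are checked to be
    the solution, q ^ t being treated as an indeterminate ([krew_expand],
    [krewE]). *)

(** * Forms and invariants of a reflection group; Chevalley's lemma *)

Section Homogeneous.

Variables (F : fieldType) (d : nat).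
Implicit Types (p q l : {mpoly F[d]}).

(** The factor is homogeneous, so multiplication by it shifts every component. *)
Lemma pihomogM k b l p :
  l \is k.-homog -> pihomog mdeg (k + b) (l * p) = l * pihomog mdeg b p.
Proof.
move=> hl; set K := maxn b.+1 (mmeasure mdeg p).
have ltbK : (b < K)%N by rewrite leq_maxl.
rewrite {1}(pihomog_partitionE (leq_maxr _ _ : (mmeasure mdeg p <= K)%N)).
rewrite mulr_sumr raddf_sum /= (bigD1 (Ordinal ltbK)) //= big1 ?addr0.
  by rewrite pihomog_dE // dhomogM // pihomogP.
move=> i nib; apply: (@pihomog_ne0 _ _ _ (k + i)).
  by apply: contra nib; rewrite eqn_add2l -val_eqE.
by rewrite dhomogM // pihomogP.
Qed.

Lemma dhomogM_low e b (l p : {mpoly F[d]}) : (b < e)%N -> l \is e.-homog ->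
  pihomog mdeg b (l * p) = 0.
Proof.
move=> ltba hl.
rewrite (pihomog_partitionE (leqnn _ : (mmeasure mdeg p <= _)%N)).
rewrite mulr_sumr raddf_sum /= big1 // => i _.
apply: (@pihomog_ne0 _ _ _ (e + i)); last by rewrite dhomogM // pihomogP.
by rewrite gtn_eqF // (leq_trans ltba) ?leq_addr.
Qed.

Lemma pihomog0C (p : {mpoly F[d]}) : pihomog mdeg 0 p = (p@_0%MM)%:MP.
Proof.
apply/mpolyP=> m; rewrite mcoeffC.
have [e|nz_m] := eqVneq 0%MM m; last first.
  rewrite mulr0; apply: (dhomog_nemf_coeff (pihomogP mdeg 0 p)).
  by rewrite /= mdeg_eq0 eq_sym.
rewrite mulr1 -{}e.
have := pihomog_partitionE (leq_maxr 1 _ : (mmeasure mdeg p <= _)%N).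
move/(congr1 (mcoeff 0%MM)) => ->.
have lt0 : (0 < maxn 1 (mmeasure mdeg p))%N by rewrite leq_maxl.
rewrite [RHS]raddf_sum (bigD1 (Ordinal lt0)) //= big1 ?addr0 // => i.
rewrite -val_eqE /= => ni0.
by apply: (dhomog_nemf_coeff (pihomogP mdeg i p)); rewrite /= mdeg0 eq_sym.
Qed.

Lemma dhomogM_cancel k b l p :
  l != 0 -> l \is k.-homog -> l * p \is (k + b).-homog -> p \is b.-homog.
Proof.
move=> nz_l hl; rewrite !homog_piE pihomogM // => /eqP/(mulfI nz_l) e.
by rewrite e.
Qed.

(** Multiplication by the polynomial, as a linear map from forms of degree n to
    forms of degree m; truncating unless the degrees match. *)
Definition mul_mx n m q : 'M[F]_(sdim d n, sdim d m) :=
  \matrix_i hcoef m ('X_[mon i] * q).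

Lemma mul_mul_mx n m q (v : 'rV[F]_(sdim d n)) :
  v *m mul_mx n m q = hcoef m (hpoly v * q).
Proof.
rewrite mulmx_sum_row /hpoly mulr_suml hcoef_sum.
by apply: eq_bigr => i _; rewrite rowK -scalerAl hcoefZ.
Qed.

Lemma hcoefD n : {morph @hcoef F d n : p q / p + q}.
Proof. by move=> p q; apply/rowP=> i; rewrite !mxE mcoeffD. Qed.

Lemma hcoef0 n : hcoef n (0 : {mpoly F[d]}) = 0.
Proof. by apply/rowP=> i; rewrite !mxE mcoeff0. Qed.

Lemma hpolyD n : {morph @hpoly F d n : u v / u + v}.
Proof.
move=> u v; rewrite /hpoly -big_split /=; apply: eq_bigr => i _.
by rewrite mxE scalerDl.
Qed.

Lemma hpoly0 n : hpoly (0 : 'rV[F]_(sdim d n)) = 0.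
Proof. by rewrite /hpoly big1 // => i _; rewrite mxE scale0r. Qed.

Lemma hpoly_eq0 n (u : 'rV[F]_(sdim d n)) : (hpoly u == 0) = (u == 0).
Proof.
apply/eqP/eqP=> [e|->]; last exact: hpoly0.
by rewrite -(hpolyK u) e hcoef0.
Qed.

Lemma lsubstB (A : 'M[F]_d) p q : lsubst A (p - q) = lsubst A p - lsubst A q.
Proof. exact: raddfB. Qed.

(** Divided differences: p |-> lsubst A p - p is a twisted derivation, so it is
    enough to divide its values at the variables by l. *)
Lemma lsubst_divided (A : 'M[F]_d) (l : {mpoly F[d]}) :
  (forall j, exists D, lsubst A 'X_j = 'X_j + l * D) ->
  forall p, exists D, lsubst A p = p + l * D.
Proof.
move=> HX p; rewrite [p]mpolyE; elim/big_ind: _ => [|p1 p2 [D1 H1] [D2 H2]|m _].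
- by exists 0; rewrite mulr0 addr0; exact: raddf0.
- by exists (D1 + D2); rewrite /lsubst raddfD /= -!/(lsubst _ _) H1 H2; ring.
suff [D HD] : exists D, lsubst A 'X_[m] = 'X_[m] + l * D.
  by exists (p@_m *: D); rewrite lsubstZ HD scalerDr scalerAr.
rewrite mpolyXE_id; elim/big_ind: _ => [|p1 p2 [D1 H1] [D2 H2]|j _].
- by exists 0; rewrite mulr0 addr0; exact: rmorph1.
- by exists (p1 * D2 + D1 * p2 + l * D1 * D2); rewrite lsubstM H1 H2; ring.
have [D HD] := HX j; elim: (m j) => [|k [E HE]].
  by exists 0; rewrite mulr0 addr0; exact: rmorph1.
by exists (D * 'X_j ^+ k + 'X_j * E + l * D * E); rewrite exprS lsubstM HE HD; ring.
Qed.

End Homogeneous.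

Section CoinvariantIdeal.

Variables (F : fieldType) (gT : finGroupType) (G : {group gT}) (d : nat).
Variable rG : mx_representation F G d.
Implicit Types (p q f g : {mpoly F[d]}).

Definition fixed_poly p := forall x, x \in G -> lsubst (rG x) p = p.

(** Membership in the ideal generated by the invariants of positive degree, for
    polynomials that are homogeneous of degree n. *)
Definition in_coinv n p := (hcoef n p <= coinv_ideal rG n)%MS.

Lemma in_coinv0 n : in_coinv n 0.
Proof. by rewrite /in_coinv hcoef0 sub0mx. Qed.

Lemma in_coinvD n p q : in_coinv n p -> in_coinv n q -> in_coinv n (p + q).
Proof. by rewrite /in_coinv hcoefD; apply: addmx_sub. Qed.

Lemma in_coinvZ n c p : in_coinv n p -> in_coinv n (c *: p).
Proof. by rewrite /in_coinv hcoefZ; apply: scalemx_sub. Qed.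

Lemma in_coinvN n p : in_coinv n p -> in_coinv n (- p).
Proof. by rewrite -scaleN1r; apply: in_coinvZ. Qed.

Lemma in_coinv_sum n (I : finType) (P : pred I) (h : I -> {mpoly F[d]}) :
  (forall i, P i -> in_coinv n (h i)) -> in_coinv n (\sum_(i | P i) h i).
Proof.
by move=> H; elim/big_rec: _ => [|i p Pi]; [exact: in_coinv0 | exact/in_coinvD/H].
Qed.

Lemma in_coinv_act n p x : p \is n.-homog -> x \in G ->
  in_coinv n p -> in_coinv n (lsubst (rG x) p).
Proof.
move=> hp Gx Ip; rewrite /in_coinv -(hcoefK hp) -mul_sym_mx.
apply: submx_trans (submxMr _ Ip) _.
exact: (mxmoduleP (coinv_ideal_module rG n) x Gx).
Qed.

(** A product of a generator f * m of the ideal with a form q is f * (m q), which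
    expands over the generators of the higher degree. *)
Lemma in_coinvM n m p q : p \is n.-homog -> q \is m.-homog ->
  in_coinv n p -> in_coinv (n + m) (p * q).
Proof.
move=> hp hq; rewrite /in_coinv -{2}(hcoefK hp) -mul_mul_mx => Ip.
apply: submx_trans (submxMr _ Ip) _; clear Ip.
rewrite {1}/coinv_ideal sumsmxMr_gen; apply/sumsmx_subP=> k k_gt0; rewrite genmxE.
rewrite sumsmxMr_gen; apply/sumsmx_subP=> r _; rewrite genmxE.
rewrite sumsmxMr_gen; apply/sumsmx_subP=> j _; rewrite genmxE.
have le_kn : (k <= n)%N by rewrite -ltnS.
have ltk : (k < (n + m).+1)%N by rewrite ltnS (leq_trans le_kn) ?leq_addr.
rewrite (eqmxMr _ (genmxE _)) mul_mul_mx.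
set f := hpoly (row r _).
have fh : f \is k.-homog by exact: hpoly_homog.
have jh : 'X_[F, mon j] \is (n - k).-homog.
  by rewrite dhomogX; apply/eqP/mdeg_mon.
have fjh : f * 'X_[F, mon j] \is n.-homog.
  by have := dhomogM fh jh; rewrite (subnKC le_kn).
rewrite (hcoefK fjh).
have jqh : 'X_[F, mon j] * q \is (n + m - k).-homog.
  by rewrite -addnBAC // dhomogM.
rewrite -mulrA -(hcoefK jqh) /hpoly mulr_sumr hcoef_sum.
apply: summx_sub => i _; rewrite -scalerAr hcoefZ scalemx_sub //.
apply: (sumsmx_sup (Ordinal ltk)) => //.
apply: (sumsmx_sup r) => //=; apply: (sumsmx_sup i) => //=.
by rewrite genmxE.
Qed.

Lemma in_coinv_inv n f : (0 < n)%N -> f \is n.-homog -> fixed_poly f -> in_coinv n f.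
Proof.
move=> n_gt0 hf invf; rewrite /in_coinv.
have /submxP[c ->] : (hcoef n f <= rfix_mx (sym_repr rG n) G)%MS.
  by apply/rfix_mxP=> x Gx; rewrite [X in _ *m X]/= mul_sym_mx hcoefK // invf.
set R := rfix_mx _ _; rewrite mulmx_sum_row; apply: summx_sub => r _.
apply: scalemx_sub; apply: (sumsmx_sup (@ord_max n)) => //.
apply: (sumsmx_sup r) => //=.
have [j ej] : exists i : 'I_(sdim d (n - n)), mon i = 0%MM.
  by apply: mon_surj; rewrite mdeg0 subnn.
apply: (sumsmx_sup j) => //; rewrite genmxE ej mpolyX0 mulr1.
by rewrite hpolyK.
Qed.

(** Stated as the property from which divided differences are formed; l is the
    root of the reflection. *)
Definition reflection (A : 'M[F]_d) :=
  exists l : {mpoly F[d]}, [/\ l != 0, l \is 1.-homog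
    & forall p, exists D, lsubst A p = p + l * D].

Variables (I : finType) (s : I -> gT).
Hypothesis genG : G :=: <<[set s i | i : I]>>%g.
Hypothesis refl_s : forall i, reflection (rG (s i)).
Hypothesis charF : (#|G|%:R : F) != 0.

Lemma s_in i : s i \in G.
Proof. by rewrite genG mem_gen // imset_f. Qed.

(** The elements x for which x g = g modulo the ideal form a subgroup, so the
    hypothesis on generators extends to G; then g equals its average modulo the
    ideal, and the average is an invariant of positive degree. *)
Lemma coinv_almost_fixed n g : (0 < n)%N -> g \is n.-homog ->
  (forall i, in_coinv n (lsubst (rG (s i)) g - g)) -> in_coinv n g.
Proof.
move=> n_gt0 hg Hs; pose T := [set x in G | in_coinv n (lsubst (rG x) g - g)].
have gT_T : group_set T.
  apply/group_setP; split=> [|x y]; rewrite !inE.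
    by rewrite group1 /= repr_mx1 lsubst1 subrr in_coinv0.
  move=> /andP[Gx Ix] /andP[Gy Iy]; rewrite (groupM Gx Gy).
  have -> : lsubst (rG (x * y)%g) g - g =
      lsubst (rG y) (lsubst (rG x) g - g) + (lsubst (rG y) g - g).
    rewrite (repr_mxM rG Gx Gy) -lsubst_comp lsubstB.
    by rewrite addrA subrK.
  apply: in_coinvD Iy; apply: in_coinv_act Gy Ix.
  exact: rpredB (lsubst_homog _ hg) hg.
have sGT : G \subset Group gT_T.
  rewrite genG gen_subG; apply/subsetP=> _ /imsetP[i _ ->].
  by rewrite !inE s_in Hs.
have avg_fix : fixed_poly (\sum_(x in G) lsubst (rG x) g).
  move=> y Gy; rewrite /lsubst raddf_sum /= -/(lsubst _ _).
  rewrite [RHS](reindex_inj (mulIg y)); apply: eq_big => [x|x Gx].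
    by rewrite groupMr.
  by rewrite -/(lsubst _ _) lsubst_comp repr_mxM.
have Iavg : in_coinv n (\sum_(x in G) lsubst (rG x) g).
  apply: in_coinv_inv => //; apply: rpred_sum => x _; exact: lsubst_homog.
have Idiff : in_coinv n (\sum_(x in G) (lsubst (rG x) g - g)).
  by apply: in_coinv_sum => x /(subsetP sGT); rewrite !inE => /andP[].
rewrite -[g](scalerK charF); apply: in_coinvZ.
have -> : #|G|%:R *: g = \sum_(x in G) lsubst (rG x) g
                         - \sum_(x in G) (lsubst (rG x) g - g).
  rewrite sumrB opprB addrCA subrr addr0 sumr_const.
  by rewrite scaler_nat.
by apply: in_coinvD => //; apply: in_coinvN.
Qed.

(** Chevalley's lemma, by induction on the degree of g j0. Applying a simple
    reflection to the relation and dividing the difference by its linear form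
    gives a relation with the divided differences of the g j, and a g j0 of
    smaller degree; hence g j0 is fixed modulo the ideal. In degree 0 a nonzero
    constant g j0 would express f j0 through the other f j. *)
Lemma chevalley b (J : finType) (f g : J -> {mpoly F[d]}) (j0 : J) :
    (forall j, fixed_poly (f j)) -> \sum_j f j * g j = 0 ->
    g j0 \is b.-homog -> (forall h, f j0 <> \sum_(j | j != j0) f j * h j) ->
  in_coinv b (g j0).
Proof.
move=> invf; elim: b g => [|b IHb] g sum0 hg indep.
  have [g0|nz_g] := eqVneq (g j0) 0; first by rewrite g0 in_coinv0.
  have [c gc] : exists c : F, g j0 = c%:MP.
    exists (g j0)@_0%MM; apply/mpolyP=> m; rewrite mcoeffC.
    have [->|nz_m] := eqVneq 0%MM m; first by rewrite mulr1.
    rewrite mulr0; apply: (dhomog_nemf_coeff hg).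
    by rewrite mdeg_eq0 eq_sym.
  have nz_c : c != 0 by apply: contraNneq nz_g => c0; rewrite gc c0 mpolyC0.
  (* The relation, divided by the constant c. *)
  case: (indep (fun j => - (c^-1) *: g j)).
  move: sum0; rewrite (bigD1 j0) //= gc mulrC mul_mpolyC => /eqP.
  rewrite addr_eq0 => /eqP E; rewrite -[f j0](scalerK nz_c) E scalerN -scaleNr.
  by rewrite scaler_sumr; apply: eq_big => // j _; rewrite scalerAr.
apply: (coinv_almost_fixed (n := b.+1)) => // i; have [l [nz_l hl Hl]] := refl_s i.
have [D HD] := fin_all_exists (fun j => Hl (g j)).
have hD : D j0 \is b.-homog.
  apply: (dhomogM_cancel nz_l hl); rewrite add1n.
  by rewrite -[_ * _](addKr (g j0)) -HD rpredD ?rpredN ?lsubst_homog.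
rewrite HD addrC addKr mulrC -addn1; apply: in_coinvM => //.
apply: IHb => //; apply: (mulfI nz_l); rewrite mulr0 mulr_sumr.
transitivity (\sum_j f j * lsubst (rG (s i)) (g j) - \sum_j f j * g j).
  rewrite -sumrB; apply: eq_big => // j _.
  by rewrite HD mulrDr addrC addKr mulrCA.
rewrite sum0 subr0; transitivity (lsubst (rG (s i)) (\sum_j f j * g j)).
  by rewrite lsubst_sum; apply: eq_bigr => j _; rewrite lsubstM invf // s_in.
by rewrite sum0; exact: raddf0.
Qed.

End CoinvariantIdeal.

(** A simple reflection adds to each variable a multiple of the variable of its
    own simple root, which therefore serves as the linear form. *)
Lemma simple_refl_reflection d (m : 'I_d -> 'I_d -> nat) i :
  reflection (simple_refl m i).
Proof.
exists 'X_i; split.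
- by rewrite -msupp_eq0 msuppX.
- by rewrite dhomogX /= mdeg1.
apply: lsubst_divided => j; exists (2 * cospi (m i j))%:MP.
rewrite lsubstXU; under eq_bigr => k _ do rewrite mxE scalerDl.
rewrite big_split /=; congr (_ + _).
  rewrite (bigD1 j) //= eqxx scale1r big1 ?addr0 // => k /negPf->.
  by rewrite scale0r.
rewrite (bigD1 i) //= eqxx mulr1 big1 ?addr0; first by rewrite [RHS]mulrC mul_mpolyC.
by move=> k /negPf->; rewrite mulr0 scale0r.
Qed.

(** * Freeness of the symmetric algebra over the invariants *)

Section Freeness.

Variables (F : fieldType) (gT : finGroupType) (G : {group gT}) (d : nat).
Variable rG : mx_representation F G d.
Variables (I : finType) (s : I -> gT).
Hypothesis genG : G :=: <<[set s i | i : I]>>%g.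
Hypothesis refl_s : forall i, reflection (rG (s i)).
Hypothesis charF : (#|G|%:R : F) != 0.

Definition inv_mx j := rfix_mx (sym_repr rG j) G.
Definition inv_dim j := \rank (inv_mx j).
Definition inv_basis j (r : 'I_(inv_dim j)) : {mpoly F[d]} :=
  hpoly (row r (row_base (inv_mx j))).

Lemma inv_basis_homog j (r : 'I_(inv_dim j)) : inv_basis r \is j.-homog.
Proof. exact: hpoly_homog. Qed.

Lemma inv_mx_fixed j (p : {mpoly F[d]}) : p \is j.-homog ->
  (hcoef j p <= inv_mx j)%MS <-> fixed_poly rG p.
Proof.
move=> hp; split=> [/rfix_mxP fixp x Gx | invp].
  have := fixp x Gx; rewrite [X in _ *m X]/= mul_sym_mx hcoefK // => e.
  by rewrite -(hcoefK (lsubst_homog (rG x) hp)) e hcoefK.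
by apply/rfix_mxP=> x Gx; rewrite [X in _ *m X]/= mul_sym_mx hcoefK // invp.
Qed.

Lemma inv_basis_fixed j (r : 'I_(inv_dim j)) : fixed_poly rG (inv_basis r).
Proof.
apply/(inv_mx_fixed (inv_basis_homog r)); rewrite hpolyK.
by rewrite (submx_trans (row_sub _ _)) // eq_row_base.
Qed.

Lemma inv_basis_free j (c : 'I_(inv_dim j) -> F) :
  \sum_r c r *: inv_basis r = 0 -> forall r, c r = 0.
Proof.
move=> sum0 r; have : \row_r c r *m row_base (inv_mx j) = 0.
  rewrite mulmx_sum_row -[RHS](hcoef0 _ d) -sum0 hcoef_sum.
  by apply: eq_bigr => i _; rewrite mxE hcoefZ hpolyK.
rewrite -[RHS](mul0mx _ (row_base (inv_mx j))).
by move/(row_free_inj (row_base_free _))/rowP/(_ r); rewrite !mxE.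
Qed.

Lemma inv_basis_span j (p : {mpoly F[d]}) : p \is j.-homog -> fixed_poly rG p ->
  exists c : 'I_(inv_dim j) -> F, p = \sum_r c r *: inv_basis r.
Proof.
move=> hp /(inv_mx_fixed hp); rewrite -(eq_row_base (inv_mx j)).
case/submxP=> c e; exists (c 0); rewrite -(hcoefK hp) e mulmx_sum_row.
rewrite /hpoly; under [LHS]eq_bigr => i _ do rewrite summxE scaler_suml.
rewrite exchange_big /=; apply: eq_bigr => r _; rewrite scaler_sumr.
by apply: eq_bigr => i _; rewrite mxE scalerA.
Qed.

Variable n : nat.

Notation idx := {k : 'I_n.+1 & 'I_(inv_dim (n - k))}.
Notation deg := (fun z : idx => nat_of_ord (tag z)).
Notation ib := (fun z : idx => inv_basis (tagged z)).

(** By downward induction on the degree of g z. Once all terms of degree above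
    deg z vanish, the remaining coefficients have degree at least n - deg z, so
    that a relation making ib z a combination of them over S would, in degree
    n - deg z, be a linear relation between basis invariants. Chevalley's lemma
    applies, and puts g z in the ideal. *)
Lemma coinv_free (g : idx -> {mpoly F[d]}) :
    (forall z, g z \is (deg z).-homog) ->
    (forall z, in_coinv rG (deg z) (g z) -> g z = 0) ->
    \sum_z ib z * g z = 0 ->
  forall z, g z = 0.
Proof.
move=> hg Ig sum0 z.
have [m] := ubnP (n - deg z); elim: m z => // m IHm z; rewrite ltnS => lemz.
apply: (Ig).
pose f (y : idx) := if (deg z < deg y)%N then 0 else ib y.
apply: (@chevalley _ _ _ _ rG _ _ genG refl_s charF _ _ f g z) => //.
- move=> y; rewrite /f; case: ifP => _; last exact: inv_basis_fixed.
  by move=> x _; exact: raddf0.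
- rewrite -[RHS]sum0; apply: eq_bigr => y _; rewrite /f.
  case: ifP => // lt_zy; rewrite (IHm y) ?mulr0 //.
  apply: leq_trans lemz; apply: ltn_sub2l => //.
  by apply: leq_trans lt_zy _; rewrite -ltnS.
move=> h; rewrite /f ltnn => e.
(* Taking the component of degree n - deg z leaves a relation with constant
   coefficients between invariants of that degree. *)
have {e} [c [cz co e]] : exists c : idx -> F,
    [/\ c z = 0, forall y, tag y != tag z -> c y = 0 & ib z = \sum_y c y *: ib y].
  exists (fun y => if (deg y == deg z) && (y != z) then (h y)@_0%MM else 0).
  split=> [|y|]; [by rewrite !eqxx | by rewrite -val_eqE /= => /negPf-> | ].
  rewrite -[LHS](pihomog_dE (inv_basis_homog _)) e raddf_sum /=.
  rewrite big_mkcond; apply: eq_bigr => y _.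
  have [->|nyz] /= := eqVneq y z; first by rewrite andbF scale0r.
  have [lt_zy|] := ltnP (deg z) (deg y).
    by rewrite mul0r raddf0 (gtn_eqF lt_zy) scale0r.
  rewrite leq_eqVlt => /orP[/eqP eyz | lt_yz].
    have -> /= : nat_of_ord (tag y) == tag z by apply/eqP.
    rewrite (_ : (n - tag z)%N = (n - tag y + 0)%N); last by rewrite addn0 eyz.
    rewrite pihomogM ?inv_basis_homog // pihomog0C.
    by rewrite mulrC mul_mpolyC.
  rewrite (ltn_eqF lt_yz) scale0r; apply: dhomogM_low (inv_basis_homog _).
  by apply: ltn_sub2l => //; apply: leq_trans lt_yz _; rewrite -ltnS.
move: c e cz co; case: z {lemz IHm f h} => k r c /= e cz co.
pose tg (i : 'I_n.+1) (j : 'I_(inv_dim (n - i))) : idx :=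
  existT (fun k : 'I_n.+1 => 'I_(inv_dim (n - k))) i j.
have := @inv_basis_free (n - k) (fun r' => (r' == r)%:R - c (tg k r')).
have -> : \sum_r' ((r' == r)%:R - c (tg k r')) *: inv_basis r' = 0.
  under eq_bigr => r' _ do rewrite scalerBl.
  rewrite sumrB (bigD1 r) //= eqxx scale1r big1 ?addr0 => [|r' /negPf->]; last first.
    by rewrite scale0r.
  apply/eqP; rewrite subr_eq0; apply/eqP; rewrite {}e.
  transitivity (\sum_i \sum_j c (tg i j) *: inv_basis j).
    rewrite (sig_big_dep (fun=> true) (fun i j => true)
               (fun i j => c (tg i j) *: inv_basis j)) /=.
    by apply: eq_big => // -[i j].
  rewrite (bigD1 k) //= [X in _ + X]big1 ?addr0 // => i nik.
  by apply: big1 => r' _; rewrite co ?scale0r.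
by move/(_ erefl r)/eqP; rewrite eqxx cz subr0 oner_eq0.
Qed.

Lemma fixed_polyM (p q : {mpoly F[d]}) :
  fixed_poly rG p -> fixed_poly rG q -> fixed_poly rG (p * q).
Proof. by move=> fp fq x Gx; rewrite lsubstM fp ?fq. Qed.

Section Span.

Variable U : forall k : 'I_n.+1, 'M[F]_(sdim d k).
Hypothesis addIU : forall k : 'I_n.+1, (coinv_ideal rG k + U k :=: 1%:M)%MS.

Definition span_part (z : idx) : 'M[F]_(sdim d n) :=
  <<U (tag z) *m mul_mx _ n (inv_basis (tagged z))>>%MS.

(** Induction on m (graded Nakayama): the part of p in the ideal has the form of a
    sum of products of an invariant g of positive degree and a form of smaller
    degree, and g * f is again invariant. *)
Lemma span_partP m (p f : {mpoly F[d]}) : (m <= n)%N -> p \is m.-homog ->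
    f \is (n - m).-homog -> fixed_poly rG f ->
  (hcoef n (p * f) <= \sum_z span_part z)%MS.
Proof.
elim/ltn_ind: m p f => m IHm p f lemn hp hf fixf.
have ltmn : (m < n.+1)%N by rewrite ltnS.
have : (hcoef m p <= coinv_ideal rG m + U (Ordinal ltmn))%MS.
  by rewrite (addIU (Ordinal ltmn)) submx1.
case/sub_addsmxP=> [[u1 u2]] /= e; rewrite -(hcoefK hp) {}e hpolyD mulrDl hcoefD.
apply: addmx_sub; last first.
  have [c ->] := inv_basis_span hf fixf.
  rewrite mulr_sumr hcoef_sum; apply: summx_sub => r _.
  rewrite -scalerAr hcoefZ; apply: scalemx_sub.
  apply: (sumsmx_sup (existT (fun k : 'I_n.+1 => 'I_(inv_dim (n - k)))
                        (Ordinal ltmn) r)) => //.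
  by rewrite genmxE /= -mul_mul_mx -mulmxA submxMl.
rewrite -mul_mul_mx -mulmxA; apply: submx_trans (submxMl _ _) _.
rewrite {1}/coinv_ideal.
rewrite sumsmxMr_gen; apply/sumsmx_subP=> k k_gt0; rewrite genmxE.
rewrite sumsmxMr_gen; apply/sumsmx_subP=> r _; rewrite genmxE.
rewrite sumsmxMr_gen; apply/sumsmx_subP=> j _; rewrite genmxE.
have le_km : (k <= m)%N by rewrite -ltnS.
rewrite (eqmxMr _ (genmxE _)) mul_mul_mx.
set g := hpoly (row r _).
have hg : g \is k.-homog by exact: hpoly_homog.
have hX : 'X_[F, mon j] \is (m - k).-homog.
  by rewrite dhomogX; apply/eqP/mdeg_mon.
have hgX : g * 'X_[F, mon j] \is m.-homog.
  by have := dhomogM hg hX; rewrite (subnKC le_km).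
have fixg : fixed_poly rG g by apply/(inv_mx_fixed hg); rewrite hpolyK row_sub.
rewrite (hcoefK hgX) mulrAC mulrC; apply: (IHm (m - k)%N) => //.
- by rewrite ltn_subrL k_gt0 (leq_trans k_gt0).
- exact: leq_trans (leq_subr _ _) lemn.
- by rewrite subnBA // addnC -addnBA // dhomogM.
exact: fixed_polyM.
Qed.

Lemma span_part_full : (\sum_z span_part z :=: 1%:M)%MS.
Proof.
apply/eqmxP; rewrite submx1 /=; apply/row_subP=> i.
rewrite -[row _ _]hpolyK -[hpoly _]mulr1; apply: (@span_partP n) => //.
- exact: hpoly_homog.
- by rewrite subnn dhomog1.
by move=> x _; exact: rmorph1.
Qed.

Hypothesis capIU : forall k : 'I_n.+1, (coinv_ideal rG k :&: U k = 0)%MS.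

(** A relation between the summands is a relation between basis invariants whose
    coefficients lie in the complements U of the ideal: [coinv_free] applies. *)
Lemma span_part_direct : mxdirect (\sum_z span_part z)%MS.
Proof.
apply/mxdirect_sumsP=> z _; apply/eqP; rewrite -submx0; apply/rV_subP=> v.
rewrite sub_capmx => /andP[]; rewrite genmxE => /submxP[w ev].
case/sub_sumsmxP=> u eu.
have {eu} [w' eu] : exists w' : forall y : idx, 'rV_(sdim d (tag y)),
    v = \sum_(y | y != z) w' y *m U (tag y) *m mul_mx _ n (inv_basis (tagged y)).
  have Hu (y : idx) : exists x : 'rV_(sdim d (tag y)),
      u y *m span_part y = x *m U (tag y) *m mul_mx _ n (inv_basis (tagged y)).
    have /submxP[x ->] : (u y *m span_part y <= U (tag y) *m
       mul_mx _ n (inv_basis (tagged y)))%MS.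
      by rewrite (submx_trans (submxMl _ _)) // genmxE.
    by exists x; rewrite mulmxA.
  have [w' Hw'] := fin_all_exists Hu.
  by exists w'; rewrite eu; apply: eq_bigr => y _; exact: Hw'.
(* The vector v in the summand z, subtracted from its other expression. *)
pose w2 := dfwith w' (- w).
pose g (y : idx) := hpoly (w2 y *m U (tag y)).
have g0 : forall y, g y = 0.
  apply: coinv_free => [y|y|]; first exact: hpoly_homog.
    rewrite /in_coinv /g hpolyK => Iy; apply/eqP; rewrite hpoly_eq0 -submx0.
    by rewrite -(capIU (tag y)) sub_capmx Iy submxMl.
  rewrite -[LHS](@hcoefK _ _ n); last first.
    apply: rpred_sum => -[k r] _ /=; have le_kn : (k <= n)%N by rewrite -ltnS.
    have := dhomogM (inv_basis_homog r) (hpoly_homog (w2 (existT _ k r) *m U k)).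
    by rewrite (subnK le_kn).
  rewrite hcoef_sum (bigD1 z) //= [X in _ + X](_ : _ = v); last first.
    rewrite eu; apply: eq_bigr => y nyz; rewrite mulrC -mul_mul_mx /w2.
    by rewrite dfwith_out // eq_sym.
  rewrite mulrC -mul_mul_mx /w2 dfwith_in mulNmx mulNmx -mulmxA -ev addNr.
  by rewrite hpoly0.
rewrite submx0 ev mulmxA; have /eqP := g0 z; rewrite /g hpoly_eq0 /w2 dfwith_in.
by rewrite mulNmx oppr_eq0 => /eqP->; rewrite mul0mx.
Qed.

End Span.

Lemma module_complement m (rH : mx_representation F G m) (A : 'M_m) :
  mxmodule rH A -> exists B : 'M_m,
  [/\ mxmodule rH B, (A + B :=: 1%:M)%MS & (A :&: B = 0)%MS].
Proof.
have p'G : ([pchar F]^'.-group G)%g by rewrite /pgroup pcharf'_nat.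
move=> modA; have [B modB addAB /mxdirect_addsP] :=
  mx_Maschke_pchar rH p'G modA (submx1 _).
by exists B.
Qed.

Lemma mul_mx_free k (f : {mpoly F[d]}) : (k <= n)%N -> f \is (n - k).-homog ->
  f != 0 -> row_free (mul_mx k n f).
Proof.
move=> lekn hf nzf; apply/inj_row_free => v; rewrite mul_mul_mx => e.
have hvf : hpoly v * f \is n.-homog.
  by have := dhomogM (hpoly_homog v) hf; rewrite (subnKC lekn).
have /eqP := hcoefK hvf; rewrite e hpoly0 eq_sym mulf_eq0 (negPf nzf) orbF.
by rewrite hpoly_eq0 => /eqP.
Qed.

Lemma inv_basis_neq0 j (r : 'I_(inv_dim j)) : inv_basis r != 0.
Proof.
apply/negP=> /eqP r0; have := @inv_basis_free j (fun i => (i == r)%:R).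
rewrite (bigD1 r) //= r0 scaler0 add0r big1 => [/(_ erefl r)/eqP|i /negPf->].
  by rewrite eqxx oner_eq0.
by rewrite scale0r.
Qed.

(** Multiplication by an invariant commutes with the action of G. *)
Lemma mul_mx_sym x m k (f : {mpoly F[d]}) (A : 'M_(m, sdim d k)) :
    (k <= n)%N -> f \is (n - k).-homog -> fixed_poly rG f -> x \in G ->
  A *m mul_mx k n f *m sym_repr rG n x = A *m sym_repr rG k x *m mul_mx k n f.
Proof.
move=> lekn hf fixf Gx; apply/row_matrixP=> i; rewrite !row_mul.
set v := row i A; rewrite !mul_mul_mx !mul_sym_mx hcoefK.
  rewrite lsubstM (fixf _ Gx) hcoefK //; exact/lsubst_homog/hpoly_homog.
by have := dhomogM (hpoly_homog v) hf; rewrite (subnKC lekn).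
Qed.

End Freeness.

Section SymmetricCharacter.

Variables (gT : finGroupType) (G : {group gT}) (d : nat).
Variable rG : mx_representation algC G d.
Variables (I : finType) (s : I -> gT).
Hypothesis genG : G :=: <<[set s i | i : I]>>%g.
Hypothesis refl_s : forall i, reflection (rG (s i)).

(** With U k a G-stable complement of the ideal in degree k, the space of forms of
    degree n is the direct sum of the products of U k with the basis invariants of
    degree n - k, each isomorphic to U k, hence to the coinvariants of degree k. *)
Lemma sym_char n :
  cfRepr (sym_repr rG n) =
  \sum_(k < n.+1) (inv_dim rG (n - k))%:R *: cfRepr (coinv_repr rG k).
Proof.
have nzG := neq0CG G.
have Hc (k : 'I_n.+1) := module_complement nzG (coinv_ideal_module rG k).
have [U HU] := fin_all_exists Hc.
pose idx := {k : 'I_n.+1 & 'I_(inv_dim rG (n - k))}.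
pose M : idx -> 'M_(sdim d n) := span_part U.
have lek (z : idx) : (tag z <= n)%N by rewrite -ltnS.
have sym_ib (z : idx) x m (A : 'M_(m, _)) : x \in G ->
    A *m mul_mx _ n (inv_basis (tagged z)) *m sym_repr rG n x
      = A *m sym_repr rG (tag z) x *m mul_mx _ n (inv_basis (tagged z)).
  by move=> Gx; rewrite mul_mx_sym ?inv_basis_homog //; exact: inv_basis_fixed.
have modM z : mxmodule (sym_repr rG n) (M z).
  apply/mxmoduleP=> x Gx; rewrite (eqmxMr _ (genmxE _)) genmxE sym_ib // submxMr //.
  by have [/mxmoduleP-> ] := HU (tag z).
have dxM : mxdirect (\sum_z M z).
  by apply: (span_part_direct genG) => // k; have [] := HU k.
have fullM : (\sum_z M z :=: 1%:M)%MS.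
  by apply: span_part_full => // k; have [] := HU k.
have simM (z : idx) : mx_rsim (submod_repr (modM z))
                    (Representation (factmod_repr (coinv_ideal_module rG (tag z)))).
  have [modU addIU capIU] := HU (tag z).
  apply: mx_rsim_trans (mx_rsim_sym _) (mx_rsim_sym (mx_rsim_factmod modU _ _ _)); last 2 first.
  - by rewrite addsmxC.
  - by apply/mxdirect_addsP; rewrite capmxC.
  pose B := mul_mx (tag z) n (inv_basis (tagged z)).
  have freeB : row_free B by rewrite mul_mx_free ?inv_basis_homog ?inv_basis_neq0.
  have defM : (M z :=: U (tag z) *m B)%MS by exact: genmxE.
  pose C := val_submod 1%:M *m B : 'M_(\rank (U (tag z)), _).
  have sCM : (C <= M z)%MS by rewrite defM submxMr // val_submodP.
  exists (in_submod (M z) C); first by rewrite defM mxrankMfree.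
    apply/inj_row_free=> v; rewrite in_submodE mulmxA -in_submodE => e.
    have := in_submodK (submx_trans (submxMl v _) sCM); rewrite e linear0.
    rewrite mulmxA -val_submodE => /esym/eqP.
    by rewrite -(mul0mx _ B) (inj_eq (row_free_inj freeB)) val_submod_eq0 => /eqP.
  move=> x Gx; rewrite -(in_submodJ (modM z)) // /C sym_ib // in_submodE mulmxA.
  rewrite -in_submodE mulmxA -val_submodE; congr (in_submod _ (_ *m B)).
  by have := val_submodJ modU 1%:M Gx; rewrite mul1mx.
rewrite -(cfRepr_sim (rsim_submod1 (mxmodule1 _) (eqmx_refl _))).
rewrite (cfRepr_sim (mx_rsim_dsum (mxmodule1 _) fullM dxM simM)) cfRepr_dsum.
transitivity (\sum_(k < n.+1) \sum_(j < inv_dim rG (n - k)) cfRepr (coinv_repr rG k)).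
  rewrite (sig_big_dep (fun=> true) (fun (k : 'I_n.+1) j => true)
    (fun (k : 'I_n.+1) (j : 'I_(inv_dim rG (n - k))) => cfRepr (coinv_repr rG k))) /=.
  by apply: eq_big => // -[k j].
apply: eq_bigr => k _; rewrite sumr_const card_ord.
by rewrite scaler_nat.
Qed.

End SymmetricCharacter.

(** * Power series expansions *)

Section Expansions.

Implicit Types (f g : Qq) (a : nat -> rat).

(** If u = v a and u' = v' a as power series, then u v' = u' v; power series are
    replaced by their truncations. *)
Lemma expands_unique f g a : expands f a -> expands g a -> f = g.
Proof.
case=> u [v [nz_v -> Hu]] [u' [v' [nz_v' -> Hu']]].
have nz (w : {poly rat}) : w`_0 != 0 -> tofrac w != 0.
  by move=> nz_w; rewrite tofrac_eq0; apply: contraNneq nz_w => ->; rewrite coef0.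
suff E : u * v' = u' * v.
  by apply/eqP; rewrite eqr_div ?nz // -!tofracM E mulrC.
apply/polyP=> n; pose A := \poly_(i < n.+1) a i.
have HA (w z : {poly rat}) : (forall m, z`_m = \sum_(i < m.+1) w`_i * a (m - i)%N) ->
    forall m, (m <= n)%N -> z`_m = (w * A)`_m.
  move=> Hz m lemn; rewrite Hz coefM; apply: eq_bigr => i _.
  by rewrite coef_poly ltnS (leq_trans (leq_subr _ _) lemn).
have HM (w w' z : {poly rat}) : (forall m, (m <= n)%N -> z`_m = (w * A)`_m) ->
    (z * w')`_n = (w * A * w')`_n.
  by move=> Hz; rewrite !coefM; apply: eq_bigr => i _; rewrite Hz // -ltnS.
rewrite (HM v) ?(HM v' v) => [||m]; try exact: HA.
  by rewrite mulrAC [v * v']mulrC mulrAC.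
Qed.

Lemma gsumE f a : expands f a -> gsum a = f.
Proof.
move=> fa; suff ga : expands (gsum a) a by exact: expands_unique ga fa.
exact: (@ClassicalEpsilon.epsilon_spec Qq _ (fun g => expands g a) (ex_intro _ f fa)).
Qed.

End Expansions.

(** * Molien's formula *)

Section FixedSpace.

Variables (gT : finGroupType) (G : {group gT}) (m : nat).
Variable rG : mx_representation algC G m.

Lemma mxtrace_idempotent (E : 'M[algC]_m) : E *m E = E -> \tr E = (\rank E)%:R.
Proof.
move=> EE; rewrite -[E in LHS](mulmx_base E) mxtrace_mulC -mxtrace1; congr (\tr _).
apply: (row_free_inj (row_base_free E)); rewrite mul1mx.
apply: (row_full_inj (col_base_full E)).
move: (mulmx_base E); move: (col_base E) (row_base E) => c r e.
by rewrite -(mulmxA r) mulmxA e EE.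
Qed.

(** The average of the group is an idempotent whose image is the fixed space. *)
Lemma rank_rfix : (\rank (rfix_mx rG G))%:R = '[cfRepr rG, 1].
Proof.
pose E := #|G|%:R^-1 *: \sum_(x in G) rG x.
have nzG := neq0CG G.
have fixE x : x \in G -> E *m rG x = E.
  move=> Gx; rewrite -scalemxAl mulmx_suml; congr (_ *: _).
  rewrite [RHS](reindex_inj (mulIg x)); apply: eq_big => [y|y Gy].
    by rewrite groupMr.
  by rewrite repr_mxM.
have idE k (A : 'M_(k, m)) : (A <= rfix_mx rG G)%MS -> A *m E = A.
  move/rfix_mxP=> fixA; rewrite -scalemxAr mulmx_sumr.
  rewrite (eq_bigr (fun=> A)) // sumr_const -scaler_nat scalerA mulVf //.
  by rewrite scale1r.
have ERle : (E <= rfix_mx rG G)%MS by apply/rfix_mxP.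
have ER : (E :=: rfix_mx rG G)%MS.
  by apply/eqmxP; rewrite ERle -{1}(idE _ _ (submx_refl _)) submxMl.
rewrite -ER -mxtrace_idempotent ?idE // cfdotE mxtraceZ raddf_sum /=.
congr (_ * _); apply: eq_bigr => x Gx.
by rewrite cfunE Gx cfun1E Gx conjC1 mulr1.
Qed.

End FixedSpace.

Section SymmetricTrace.

Variables (F : fieldType) (d : nat).
Implicit Types (A B : 'M[F]_d) (x : 'rV[F]_d).

Lemma mxtrace_sym_conj n A B : B \in unitmx ->
  \tr (sym_mx n (invmx B *m A *m B)) = \tr (sym_mx n A).
Proof.
move=> uB; rewrite !sym_mxM mxtrace_mulC mulmxA -sym_mxM mulmxV //.
by rewrite sym_mx1 mul1mx.
Qed.

Lemma mxtrace_ext_conj k A B : B \in unitmx ->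
  \tr (ext_mx k (invmx B *m A *m B)) = \tr (ext_mx k A).
Proof.
move=> uB; rewrite !ext_mxM mxtrace_mulC mulmxA -ext_mxM mulmxV //.
by rewrite ext_mx1 mul1mx.
Qed.

Lemma mxtrace_sym_diag n x :
  \tr (sym_mx n (diag_mx x)) = \sum_(i < sdim d n) \prod_k x 0 k ^+ mon i k.
Proof.
apply: eq_bigr => i _; rewrite !mxE /lsubst comp_mpolyX.
transitivity ((\prod_k (x 0 k *: 'X_k) ^+ mon i k)@_(mon i)).
  congr (_@__); apply: eq_bigr => k _; rewrite tnth_mktuple; congr (_ ^+ _).
  rewrite (bigD1 k) //= big1 ?addr0 => [|j njk]; first by rewrite mxE eqxx mulr1n.
  by rewrite mxE eq_sym (negPf njk) scale0r.
under eq_bigr => k _ do rewrite exprZn.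
by rewrite scaler_prod -mpolyXE_id mcoeffZ mcoeffX eqxx mulr1.
Qed.

(** The coefficient of X ^ n in the product of the geometric series of the x k,
    truncated at an exponent N that is at least n. *)
Lemma sum_mon_coef n N x : (n < N.+1)%N ->
  \sum_(i < sdim d n) \prod_k x 0 k ^+ mon i k =
  (\prod_k \sum_(j < N.+1) (x 0 k *: 'X) ^+ j)`_n.
Proof.
move=> ltnN; rewrite bigA_distr_bigA coef_sum /=.
pose h (i : 'I_(sdim d n)) : {ffun 'I_d -> 'I_N.+1} := [ffun k => inord (mon i k)].
have hE i k : h i k = mon i k :> nat.
  have : (mon i k <= mdeg (mon i))%N by rewrite mdegE (bigD1 k) //= leq_addr.
  by rewrite mdeg_mon ffunE => lein; rewrite inordK // (leq_ltn_trans lein ltnN).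
have inj_h : injective h.
  move=> i j e; apply: mon_inj; apply/mnmP=> k.
  by rewrite -!hE e.
have coefE (f : {ffun 'I_d -> 'I_N.+1}) : (\prod_k (x 0 k *: 'X) ^+ f k)`_n =
    if (\sum_k f k == n)%N then \prod_k x 0 k ^+ f k else 0.
  under eq_bigr => k _ do rewrite exprZn.
  rewrite scaler_prod -expr_sum coefZ coefXn eq_sym.
  by case: eqP => _; rewrite ?mulr1 ?mulr0.
under [RHS]eq_bigr => f _ do rewrite coefE.
rewrite -big_mkcond /= (eq_bigl (fun f => f \in [set h i | i : 'I_(sdim d n)])).
  rewrite big_imset /=; last by move=> i j _ _; exact: inj_h.
  by apply: eq_big => // i _; apply: eq_bigr => k _; rewrite hE.
move=> f; apply/eqP/imsetP=> [sf | [i _ ->]].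
  have [i ei] : exists i : 'I_(sdim d n), mon i = [multinom (f k : nat) | k < d].
    by apply: mon_surj; rewrite mdegE -sf; apply: eq_bigr => k _; rewrite mnmE.
  by exists i => //; apply/ffunP=> k; apply/val_inj; rewrite /= hE ei mnmE.
by apply: etrans (mdeg_mon i); rewrite mdegE; apply: eq_bigr => k _; rewrite hE.
Qed.

(** Multiplying the truncated geometric series by the factors 1 - x k X leaves 1
    modulo X ^ (n + 1). *)
Lemma sym_trace_series x (v p : {poly F}) n :
  v = p * \prod_k (1 - x 0 k *: 'X) ->
  \sum_(i < n.+1) v`_i * \tr (sym_mx (n - i) (diag_mx x)) = p`_n.
Proof.
move=> ev; pose H := \prod_k \sum_(j < n.+1) (x 0 k *: 'X) ^+ j.
transitivity ((v * H)`_n).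
  rewrite coefM; apply: eq_bigr => i _; rewrite mxtrace_sym_diag.
  by rewrite (@sum_mon_coef _ n) // ltnS leq_subr.
have -> : v * H = p * \prod_k (1 - (x 0 k *: 'X) ^+ n.+1).
  rewrite ev -mulrA -big_split /=; congr (_ * _); apply: eq_bigr => k _.
  by rewrite -opprB mulNr -subrX1 opprB.
have [r ->] : exists r, \prod_k (1 - (x 0 k *: 'X) ^+ n.+1) = 1 + 'X^(n.+1) * r.
  elim/big_ind: _ => [|y z [r1 ->] [r2 ->]|k _].
  - by exists 0; rewrite mulr0 addr0.
  - by exists (r1 + r2 + 'X^(n.+1) * r1 * r2); ring.
  by exists (- (x 0 k ^+ n.+1)%:P); rewrite exprZn -mul_polyC; ring.
by rewrite mulrDr mulr1 mulrCA coefD coefXnM ltnSn addr0.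
Qed.

End SymmetricTrace.

Section ExteriorTrace.

Variable F : fieldType.

(** Together with the next two lemmas, this turns the sums over increasing tuples
    that define exterior traces into explicit sums of minors. *)
Lemma big_tuple_cons (R : nmodType) (T : finType) k (f : k.+1.-tuple T -> R) :
  \sum_t f t = \sum_x \sum_(t : k.-tuple T) f [tuple of x :: t].
Proof.
rewrite pair_bigA /= (reindex (fun p : T * k.-tuple T => [tuple of p.1 :: p.2])) //.
exists (fun t : k.+1.-tuple T => (thead t, [tuple of behead t])) => [[x t] _ | t _] /=.
  by congr (_, _); apply/val_inj.
by rewrite -tuple_eta.
Qed.

Lemma big_tuple0 (R : nmodType) (T : finType) (f : 0.-tuple T -> R) :
  \sum_t f t = f [tuple].
Proof.
rewrite (bigD1 [tuple]) //= big1 ?addr0 // => t.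
by rewrite [t]tuple0 => /eqP[].
Qed.

Lemma sum_inc d k (R : nmodType) (f : ('I_k -> 'I_d) -> R) :
  \sum_(i < edim d k) f (inc i) =
  \sum_(t : k.-tuple 'I_d) if sorted ltn (map val t) then f (tnth t) else 0.
Proof.
rewrite -big_mkcond /= -(big_enum_val (A := {: incr d k}) (fun t => f (tnth (val t)))).
rewrite [RHS](reindex_omap (val : incr d k -> _) insub) /= => [|t Pt]; last first.
  by rewrite insubT.
by apply: eq_bigl => t; rewrite valK eqxx andbT (valP t).
Qed.

Lemma det_mx22 (M : 'M[F]_2) : \det M = M 0 0 * M 1 1 - M 0 1 * M 1 0.
Proof.
rewrite (expand_det_row _ 0) !big_ord_recl big_ord0 /cofactor !det_mx11 !mxE /=.
have e0 : lift (0 : 'I_2) (0 : 'I_1) = 1 by exact/val_inj.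
have e1 : lift (1 : 'I_2) (0 : 'I_1) = 0 by exact/val_inj.
have e2 : lift ord0 (ord0 : 'I_1) = 1 by exact/val_inj.
rewrite ?e2 ?e0 ?e1.
by rewrite expr0 expr1; ring.
Qed.

Definition o0 : 'I_3 := @Ordinal 3 0 isT.
Definition o1 : 'I_3 := @Ordinal 3 1 isT.
Definition o2 : 'I_3 := @Ordinal 3 2 isT.

Lemma big_ord3 (R : nmodType) (f : 'I_3 -> R) : \sum_i f i = f o0 + (f o1 + f o2).
Proof.
rewrite !big_ord_recl big_ord0 addr0.
by congr (f _ + (f _ + f _)); apply/val_inj.
Qed.

Variable A : 'M[F]_3.

Lemma mxtrace_ext0 : \tr (ext_mx 0 A) = 1.
Proof.
rewrite /mxtrace; under eq_bigr => i _ do rewrite mxE.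
by rewrite (sum_inc (fun g => \det (mxsub g g A))) big_tuple0 /= det_mx00.
Qed.

Lemma mxtrace_ext1 : \tr (ext_mx 1 A) = A o0 o0 + (A o1 o1 + A o2 o2).
Proof.
rewrite /mxtrace; under eq_bigr => i _ do rewrite mxE.
rewrite (sum_inc (fun g => \det (mxsub g g A))) big_tuple_cons.
under eq_bigr => i _ do rewrite big_tuple0 /= det_mx11 mxE.
by rewrite big_ord3.
Qed.

Lemma mxtrace_ext2 : \tr (ext_mx 2 A) =
  A o0 o0 * A o1 o1 - A o0 o1 * A o1 o0
  + (A o0 o0 * A o2 o2 - A o0 o2 * A o2 o0)
  + (A o1 o1 * A o2 o2 - A o1 o2 * A o2 o1).
Proof.
rewrite /mxtrace; under eq_bigr => i _ do rewrite mxE.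
rewrite (sum_inc (fun g => \det (mxsub g g A))) big_tuple_cons.
under eq_bigr => i _ do rewrite big_tuple_cons.
under eq_bigr => i _ do under eq_bigr => j _ do rewrite big_tuple0 /= det_mx22 !mxE.
rewrite big_ord3 !big_ord3 /=.
rewrite !add0r !addr0 addrA.
by [].
Qed.

Lemma mxtrace_ext3 : \tr (ext_mx 3 A) = \det A.
Proof.
rewrite /mxtrace; under eq_bigr => i _ do rewrite mxE.
rewrite (sum_inc (fun g => \det (mxsub g g A))) big_tuple_cons.
under eq_bigr => i _ do rewrite big_tuple_cons.
under eq_bigr => i _ do under eq_bigr => j _ do rewrite big_tuple_cons.
under eq_bigr => i _ do under eq_bigr => j _ do under eq_bigr => k _ do
  rewrite big_tuple0 /=.
rewrite big_ord3 !big_ord3 /= !add0r !addr0.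
congr (\det _); apply/matrixP=> i j; rewrite mxE.
have E k : tnth [tuple o0; o1; o2] k = k.
  by apply/val_inj; case: k => [[|[|[|k]]]].
by rewrite !E.
Qed.

End ExteriorTrace.

(** The characteristic polynomial in the form det (1 - X A). *)
Lemma ext_diag_charpoly (F : fieldType) (x : 'rV[F]_3) :
  \sum_(k < 4) (-1) ^+ k * (\tr (ext_mx k (diag_mx x)))%:P * 'X^k =
  \prod_k (1 - x 0 k *: 'X).
Proof.
rewrite !big_ord_recl !big_ord0 /= mxtrace_ext0 mxtrace_ext1 mxtrace_ext2 mxtrace_ext3.
rewrite det_diag !big_ord_recl !big_ord0 /= !mxE /=.
have e2 : lift ord0 (lift ord0 ord0) = o2 by exact/val_inj.
have e1 : lift ord0 ord0 = o1 by exact/val_inj.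
have e0 : ord0 = o0 by exact/val_inj.
rewrite e2 e1 e0.
rewrite !mulr1n !mulr0n ?mulr0 ?subr0 -!mul_polyC !(polyCD, polyCM).
by rewrite /bump /=; ring.
Qed.

Section Molien.

Variables (gT : finGroupType) (G : {group gT}).
Variable rG : mx_representation algC G 3.

(** Molien's formula at one element: if the polynomial v is p times
    det (1 - X g), then v times the series of the traces of g on symmetric powers
    is p. *)
Lemma molien_coef (g : gT) (v p : {poly algC}) n : g \in G ->
    v = p * \sum_(k < 4) (-1) ^+ k * (extC rG k g)%:P * 'X^k ->
  \sum_(i < n.+1) v`_i * symC rG (n - i) g = p`_n.
Proof.
move=> Gg; have [x [[B uB eB] _ _ _]] := repr_rsim_diag rG Gg.
have eE k : extC rG k g = \tr (ext_mx k (diag_mx x)).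
  by rewrite cfunE Gg mulr1n /= eB mxtrace_ext_conj.
under [in X in v = X -> _]eq_bigr => k _ do rewrite eE.
rewrite ext_diag_charpoly => /sym_trace_series <-; apply: eq_bigr => i _.
by rewrite cfunE Gg mulr1n /= eB mxtrace_sym_conj.
Qed.

End Molien.

(** * The ring generated by the golden ratio *)

Section Cosines.

(** The chosen m-th root z of -1 lies on the unit circle, so 2 Re z = z + 1 / z. *)
Lemma cospi_root m : (0 < m)%N ->
  2 * cospi m = m.-root (-1) + (m.-root (-1))^-1 /\ m.-root (-1) != 0 :> algC.
Proof.
move=> m_gt0; set z := m.-root (-1).
have z1 : `|z| = 1 by rewrite norm_rootC normrN1 rootC1.
have nz : z != 0 by rewrite -normr_eq0 z1 oner_eq0.
split=> //; rewrite /cospi -/z invC_norm z1 expr1n invr1 mul1r.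
by rewrite ReE mulrC divfK ?pnatr_eq0.
Qed.

Lemma rootN1_neqN1 m : (1 < m)%N -> m.-root (-1) + 1 != 0 :> algC.
Proof.
move=> m_gt1; apply/negP; rewrite addr_eq0 => /eqP e.
by have := rootC_lt0 (-1 : algC) m_gt1; rewrite e oppr_lt0 ltr01.
Qed.

Lemma cospi1 : 2 * cospi 1 = - 2 :> algC.
Proof. by have [-> _] := cospi_root (isT : 0 < 1)%N; rewrite root1C invrN1; ring. Qed.

Lemma cospi2 : 2 * cospi 2 = 0 :> algC.
Proof.
have [-> nz] := cospi_root (isT : 0 < 2)%N.
have := rootCK (isT : 0 < 2)%N (-1 : algC); set z := 2.-root _ in nz *.
move=> z2; apply: (mulfI nz); rewrite mulrDr mulfV // -expr2 z2.
by ring.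
Qed.

Lemma cospi3 : 2 * cospi 3 = 1 :> algC.
Proof.
have [-> nz] := cospi_root (isT : 0 < 3)%N.
have := rootCK (isT : 0 < 3)%N (-1 : algC); have := @rootN1_neqN1 3 isT.
set z := 3.-root _ in nz * => nz1 z3; apply: (mulfI nz); apply: (mulfI nz1).
rewrite mulrDr mulfV // mulr1; apply/eqP; rewrite -subr_eq0; apply/eqP.
transitivity (z ^+ 3 + 1); first by ring.
by rewrite z3; ring.
Qed.

Definition tau : algC := 2 * cospi 5.

(** The fifth root z of -1 is not -1, hence a zero of (X ^ 5 + 1) / (X + 1). *)
Lemma tau_quintic : exists z : algC,
  [/\ z ^+ 10 = 1, z ^+ 4 = z ^+ 3 - z ^+ 2 + z - 1, z != 0 & tau = z + z^-1].
Proof.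
have [e nz] := cospi_root (isT : 0 < 5)%N.
have := rootCK (isT : 0 < 5)%N (-1 : algC); have := @rootN1_neqN1 5 isT.
rewrite /tau e; set z := 5.-root _ in nz * => nz1 z5; exists z; split=> //.
  by rewrite (exprM z 5 2) z5 sqrrN expr1n.
apply: (mulfI nz1); apply/eqP; rewrite -subr_eq0; apply/eqP.
transitivity (z ^+ 5 + 1); first by ring.
by rewrite z5; ring.
Qed.

Lemma tau_sqr : tau ^+ 2 = tau + 1.
Proof.
have [z [_ z4 nz ->]] := tau_quintic.
have nz2 : z ^+ 2 != 0 by rewrite expf_neq0.
apply: (mulfI nz2); transitivity (z ^+ 4 + 2 * z ^+ 2 + 1); first by field.
by rewrite z4; field.
Qed.

Lemma tau_real : tau^* = tau.
Proof. by rewrite /tau /cospi rmorphM /= rmorph_nat conj_Creal ?Creal_Re. Qed.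

(** The automorphism z |-> z ^ 3 of the field of tenth roots of unity is the Galois
    conjugation of Q(tau). *)
Lemma tau_aut : exists u : {rmorphism algC -> algC}, u tau = 1 - tau.
Proof.
have [z [z10 z4 nz et]] := tau_quintic.
have [u Hu] := @Qn_aut_exists 3 10 isT; exists u.
rewrite et rmorphD fmorphV /= (Hu z z10).
have nz3 : z ^+ 3 != 0 by rewrite expf_neq0.
apply: (mulfI nz3).
transitivity (z ^+ 2 * z ^+ 4 + 1); first by field.
transitivity (z ^+ 3 - z * z ^+ 3 - z ^+ 2); last by field.
rewrite z4; have -> : z ^+ 2 * (z ^+ 3 - z ^+ 2 + z - 1) =
   z * z ^+ 4 - z ^+ 4 + z ^+ 3 - z ^+ 2 by ring.
have -> : z * z ^+ 3 = z ^+ 4 by ring.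
have -> : z * z ^+ 4 = z * (z ^+ 3 - z ^+ 2 + z - 1) by rewrite z4.
have -> : z * (z ^+ 3 - z ^+ 2 + z - 1) = z ^+ 4 - z ^+ 3 + z ^+ 2 - z by ring.
by rewrite z4; ring.
Qed.

End Cosines.

(** The pair (a, b) stands for a + b tau; the ring Z[tau] is represented by pairs of
    binary integers in order to compute in it. *)
Definition zt := (Z * Z)%type.
Definition zt_of_Z (a : Z) : zt := (a, Z0).
Definition zt_add (x y : zt) : zt := (Z.add x.1 y.1, Z.add x.2 y.2).
Definition zt_opp (x : zt) : zt := (Z.opp x.1, Z.opp x.2).
Definition zt_mul (x y : zt) : zt :=
  let b := Z.mul x.2 y.2 in
  (Z.add (Z.mul x.1 y.1) b, Z.add (Z.add (Z.mul x.1 y.2) (Z.mul x.2 y.1)) b).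
Definition zt_conj (x : zt) : zt := (Z.add x.1 x.2, Z.opp x.2).
Definition zt0 : zt := (Z0, Z0).
Definition zt1 : zt := (Zpos xH, Z0).
Definition zt_tau : zt := (Z0, Zpos xH).

Section Values.

(** The values of an integer and of an element of Z[tau] as algebraic numbers. *)
Definition zc (a : Z) : algC := (int_of_Z a)%:~R.
Definition ct (x : zt) : algC := zc x.1 + zc x.2 * tau.

Lemma zcD a b : zc (Z.add a b) = zc a + zc b.
Proof. by rewrite /zc -[Z.add a b]/(a + b) rmorphD /= intrD. Qed.
Lemma zcM a b : zc (Z.mul a b) = zc a * zc b.
Proof. by rewrite /zc -[Z.mul a b]/(a * b) rmorphM /= intrM. Qed.
Lemma zcN a : zc (Z.opp a) = - zc a.
Proof. by rewrite /zc -[Z.opp a]/(- a) rmorphN /= rmorphN. Qed.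
Lemma zc0 : zc Z0 = 0. Proof. by []. Qed.
Lemma zc1 : zc (Zpos xH) = 1. Proof. by []. Qed.

Lemma ct0 : ct zt0 = 0. Proof. by rewrite /ct /= zc0 mul0r addr0. Qed.
Lemma ct1 : ct zt1 = 1. Proof. by rewrite /ct /= zc0 zc1 mul0r addr0. Qed.
Lemma ct_tau : ct zt_tau = tau. Proof. by rewrite /ct /= zc0 zc1 mul1r add0r. Qed.
Lemma ctZ a : ct (zt_of_Z a) = zc a. Proof. by rewrite /ct /= zc0 mul0r addr0. Qed.
Lemma ctD x y : ct (zt_add x y) = ct x + ct y.
Proof. by rewrite /ct !zcD; ring. Qed.
Lemma ctN x : ct (zt_opp x) = - ct x.
Proof. by rewrite /ct !zcN; ring. Qed.
Lemma ctM x y : ct (zt_mul x y) = ct x * ct y.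
Proof.
rewrite /ct /= !(zcD, zcM); set a := zc x.1; set b := zc x.2.
set c := zc y.1; set d := zc y.2.
transitivity (a * c + (a * d + b * c) * tau + b * d * (tau + 1)); first by ring.
by rewrite -tau_sqr; ring.
Qed.

Lemma ct_real x : (ct x)^* = ct x.
Proof. by rewrite /ct /zc rmorphD rmorphM /= tau_real !rmorph_int. Qed.

Lemma ct_aut (u : {rmorphism algC -> algC}) x :
  u tau = 1 - tau -> u (ct x) = ct (zt_conj x).
Proof.
by move=> ut; rewrite /ct rmorphD rmorphM ut /= zcD zcN /zc !rmorph_int; ring.
Qed.

Lemma zc_inj : injective zc.
Proof. by move=> a b /intr_inj /(can_inj int_of_ZK). Qed.

(** If a + b tau = 0, conjugating and subtracting gives b (1 - 2 tau) = 0, and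
    (1 - 2 tau) ^ 2 = 5. *)
Lemma ct_inj : injective ct.
Proof.
have [u ut] := tau_aut.
have nz : 1 - 2 * tau != 0.
  have: (1 - 2 * tau) ^+ 2 != 0.
    have -> : (1 - 2 * tau) ^+ 2 = 1 - 4 * tau + 4 * tau ^+ 2 by ring.
    rewrite tau_sqr (_ : _ + _ = 5%:R); last by ring.
    by rewrite pnatr_eq0.
  by rewrite expf_eq0.
have ker x : ct x = 0 -> x = zt0.
  move=> x0; have: u (ct x) - ct x = 0 by rewrite x0 rmorph0 subr0.
  rewrite (ct_aut _ ut) /ct /= zcD zcN => E.
  have b0 : zc x.2 = 0.
    by apply: (mulIf nz); rewrite mul0r -[RHS]E; ring.
  have a0 : zc x.1 = 0 by rewrite -[RHS]x0 /ct b0 mul0r addr0.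
  by case: x {x0 E} a0 b0 => a b /=; rewrite -zc0 => /zc_inj-> /zc_inj->.
move=> x y exy; have : zt_add x (zt_opp y) = zt0.
  by apply: ker; rewrite ctD ctN exy subrr.
case: x y {exy} => a b [c e] [/= H1 H2].
by congr (_, _); apply: (proj1 (Z.sub_move_0_r _ _)).
Qed.

End Values.

(** * The 120 elements of the group *)

(** The Coxeter relations oriented for ShortLex with a < b < c, followed by the
    three rules that complete them: each comes from reducing one word in two ways
    (c b c a, then c b a c b c, then c b a b c b a b a b). A variable x on the
    right lets each rule be applied inside a longer word. *)
Lemma h3_relations (gT : finGroupType) (a b c : gT) :
    (a * a = 1)%g -> (b * b = 1)%g -> (c * c = 1)%g ->
    ((a * b) ^+ 5 = 1)%g -> ((a * c) ^+ 2 = 1)%g -> ((b * c) ^+ 3 = 1)%g ->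
  [/\ [/\ forall x, (a * (a * x) = x)%g, forall x, (b * (b * x) = x)%g
         & forall x, (c * (c * x) = x)%g],
      [/\ forall x, (c * (a * x) = a * (c * x))%g,
      forall x, (c * (b * (c * x)) = b * (c * (b * x)))%g
      & forall x, (b * (a * (b * (a * (b * x)))) = a * (b * (a * (b * (a * x)))))%g]
    & [/\ forall x, (c * (b * (a * (c * x))) = b * (c * (b * (a * x))))%g,
          forall x, (c * (b * (a * (b * (c * (b * x)))))
                     = b * (c * (b * (a * (b * (c * x))))))%g
        & forall x,
          (c * (b * (a * (b * (a * (c * (b * (a * (b * (a * x)))))))))
           = b * (c * (b * (a * (b * (a * (c * (b * (a * (b * x))))))))))%g]].
Proof.
move=> aa bb cc; rewrite !expgS expg0 !mulg1 -!mulgA => ab ac bc.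
have aK x : (a * (a * x) = x)%g by rewrite mulgA aa mul1g.
have bK x : (b * (b * x) = x)%g by rewrite mulgA bb mul1g.
have cK x : (c * (c * x) = x)%g by rewrite mulgA cc mul1g.
have caK x : (c * (a * x) = a * (c * x))%g.
  apply: (mulgI c); apply: (mulgI a); rewrite cK aK.
  by move/(congr1 (mulg^~ x)): ac; rewrite mul1g -!mulgA.
have cbcK x : (c * (b * (c * x)) = b * (c * (b * x)))%g.
  apply: (mulgI b); apply: (mulgI c); apply: (mulgI b); rewrite bK cK bK.
  by move/(congr1 (mulg^~ x)): bc; rewrite mul1g -!mulgA.
have babK x : (b * (a * (b * (a * (b * x)))) = a * (b * (a * (b * (a * x)))))%g.
  apply: (mulgI a); apply: (mulgI b); apply: (mulgI a); apply: (mulgI b).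
  apply: (mulgI a); rewrite aK bK aK bK aK.
  by move/(congr1 (mulg^~ x)): ab; rewrite mul1g -!mulgA.
have r7 x : (c * (b * (a * (c * x))) = b * (c * (b * (a * x))))%g.
  by rewrite -caK cbcK.
have r8 x : (c * (b * (a * (b * (c * (b * x)))))
             = b * (c * (b * (a * (b * (c * x))))))%g.
  by rewrite -cbcK r7.
split=> //; split=> // x.
by rewrite -caK -babK r8 caK.
Qed.

Section Words.

Definition word := seq nat.

(** A complete rewriting system for the group; the letters 0, 1, 2 stand for the
    generators in the order of the diagram 0 -5- 1 -3- 2. *)
Definition rules : seq (word * word) :=
  [:: ([:: 0; 0], [::]); ([:: 1; 1], [::]); ([:: 2; 2], [::]);
      ([:: 2; 0], [:: 0; 2]); ([:: 2; 1; 2], [:: 1; 2; 1]);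
      ([:: 1; 0; 1; 0; 1], [:: 0; 1; 0; 1; 0]);
      ([:: 2; 1; 0; 2], [:: 1; 2; 1; 0]);
      ([:: 2; 1; 0; 1; 2; 1], [:: 1; 2; 1; 0; 1; 2]);
      ([:: 2; 1; 0; 1; 0; 2; 1; 0; 1; 0],
       [:: 1; 2; 1; 0; 1; 0; 2; 1; 0; 1])]%N.

Fixpoint rewrite_head (rs : seq (word * word)) (w : word) : option word :=
  if rs is (l, r) :: rs' then
    if prefix l w then Some (r ++ drop (size l) w) else rewrite_head rs' w
  else None.

Fixpoint rewrite_word (w : word) : option word :=
  if rewrite_head rules w is Some w' then Some w' else
  if w is x :: w' then omap (cons x) (rewrite_word w') else None.

Fixpoint normalize n (w : word) : word :=
  if n is n'.+1 then
    if rewrite_word w is Some w' then normalize n' w' else w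
  else w.

(** Normal forms, factored along the parabolic chain: coset representatives of
    <0> in <0, 1> and of <0, 1> in the whole group are put on the right. *)
Definition W_words : seq word :=
  [seq x ++ y | x <- [seq u ++ v | u <- [:: [::]; [:: 0]],
                      v <- [:: [::]; [:: 1]; [:: 1; 0]; [:: 1; 0; 1]; [:: 1; 0; 1; 0]]],
                y <- [:: [::]; [:: 2]; [:: 2; 1]; [:: 2; 1; 0]; [:: 2; 1; 0; 1];
                      [:: 2; 1; 0; 1; 0]; [:: 2; 1; 0; 1; 2]; [:: 2; 1; 0; 1; 0; 2];
                      [:: 2; 1; 0; 1; 0; 2; 1]; [:: 2; 1; 0; 1; 0; 2; 1; 0];
                      [:: 2; 1; 0; 1; 0; 2; 1; 0; 1];
                      [:: 2; 1; 0; 1; 0; 2; 1; 0; 1; 2]]]%N.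

(** Twenty rewriting steps are enough to bring a normal form followed by a letter
    back to a normal form. *)
Lemma W_words_closed :
  all (fun w => all (fun i => normalize 20 (rcons w i) \in W_words) [:: 0; 1; 2]%N) W_words.
Proof. by vm_compute. Qed.

Variables (gT : finGroupType) (W : {group gT}) (s : 'I_3 -> gT).
Hypothesis genW : W :=: <<[set s i | i : 'I_3]>>%g.
Hypothesis relW : forall i j, ((s i * s j) ^+ H3_matrix i j = 1)%g.

(** Letters are natural numbers, so that words can be computed with; only the
    letters below 3 are meant. *)
Definition wordg (w : word) : gT := foldr (fun i x => s (inord i) * x)%g 1%g w.

Lemma wordg_cat u v : wordg (u ++ v) = (wordg u * wordg v)%g.
Proof. by elim: u => [|i u IHu] /=; rewrite ?mul1g // IHu mulgA. Qed.

Lemma rules_sound l r : (l, r) \in rules -> wordg l = wordg r.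
Proof.
have rel i j : (i < 3)%N -> (j < 3)%N -> forall m,
    nth 0%N (nth [::] [:: [:: 1; 5; 2]; [:: 5; 1; 3]; [:: 2; 3; 1]]%N i) j = m ->
    ((s (inord i) * s (inord j)) ^+ m = 1)%g.
  move=> i3 j3 m <-; have := relW (inord i) (inord j).
  by rewrite /H3_matrix !inordK.
have aa := rel 0 0 isT isT 1 erefl; have bb := rel 1 1 isT isT 1 erefl.
have cc := rel 2 2 isT isT 1 erefl; have ab := rel 0 1 isT isT 5 erefl.
have ac := rel 0 2 isT isT 2 erefl; have bc := rel 1 2 isT isT 3 erefl.
move: aa bb cc ab ac bc {rel}; rewrite !expg1 => aa bb cc ab ac bc.
have [[aK bK cK] [caK cbcK babK] [r7 r8 r9]] := h3_relations aa bb cc ab ac bc.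
rewrite /rules !inE; do 8?[case/orP]; move=> /eqP[-> ->] //=;
  by rewrite ?(aK, bK, cK, r9, r8, babK, r7, cbcK, caK).
Qed.

Lemma rewrite_head_sound rs w w' : {subset rs <= rules} ->
  rewrite_head rs w = Some w' -> wordg w = wordg w'.
Proof.
elim: rs => //= -[l r] rs IHrs sub; case: ifP => [/prefixP[v ->] [<-] | _]; last first.
  by apply: IHrs => x rs_x; rewrite sub // inE rs_x orbT.
by rewrite drop_size_cat // !wordg_cat (rules_sound (sub _ (mem_head _ _))).
Qed.

Local Arguments rewrite_head : simpl never.

Lemma rewrite_word_sound w w' : rewrite_word w = Some w' -> wordg w = wordg w'.
Proof.
elim: w w' => [|x w IHw] w' //=.
case E: (rewrite_head _ _) => [v|].
  by case=> <-; exact: (rewrite_head_sound (fun _ => id) E).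
case E2: (rewrite_word w) => [v|] //= [<-] /=.
by rewrite (IHw _ E2).
Qed.

Lemma normalize_sound n w : wordg (normalize n w) = wordg w.
Proof.
elim: n w => //= n IHn w; case E: rewrite_word => [w'|//].
by rewrite IHn (rewrite_word_sound E).
Qed.

Lemma W_wordsP x : x \in W -> exists2 w, w \in W_words & x = wordg w.
Proof.
rewrite genW => /gen_prodgP[n [c Hc ->]]; elim: n c Hc => [|n IHn] c Hc.
  by exists [::]; rewrite // big_ord0.
rewrite big_ord_recr /=.
have [i _ ->] := imsetP (Hc ord_max).
have [w Ww ->] := IHn (fun j => c (widen_ord (leqnSn n) j)) (fun j => Hc _).
exists (normalize 20 (rcons w i)).
  have /allP/(_ w Ww)/allP := W_words_closed; apply.
  by case: i => [[|[|[|i]]]].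
rewrite normalize_sound -cats1 wordg_cat /= inord_val.
by rewrite mulg1.
Qed.

Lemma wordg_in w : wordg w \in W.
Proof.
elim: w => [|i w IHw] /=; first exact: group1.
by rewrite groupM // genW mem_gen // imset_f.
Qed.

End Words.

(** * Matrices, conjugacy classes and class functions *)

Definition zmat := seq (seq zt).
Definition mget (M : zmat) i j : zt := nth zt0 (nth [::] M i) j.
Definition mbuild (f : nat -> nat -> zt) : zmat :=
  [seq [seq f i j | j <- iota 0 3] | i <- iota 0 3].
Definition zmat_mul (A B : zmat) : zmat := mbuild (fun i k =>
  zt_add (zt_mul (mget A i 0) (mget B 0 k))
    (zt_add (zt_mul (mget A i 1) (mget B 1 k)) (zt_mul (mget A i 2) (mget B 2 k)))).
Definition zmat1 : zmat := mbuild (fun i j => if i == j then zt1 else zt0).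
(** 2 cos (pi / m) for m = 1, 2, 3, 5, the entries of the Coxeter matrix. *)
Definition zt_cos (m : nat) : zt :=
  nth zt0 [:: zt0; (Zneg (xO xH), Z0); zt0; zt1; zt0; zt_tau] m.
Definition H3_entry i j : nat :=
  nth 0%N (nth [::] [:: [:: 1; 5; 2]; [:: 5; 1; 3]; [:: 2; 3; 1]]%N i) j.
Definition zmat_refl i : zmat := mbuild (fun j k =>
  zt_add (if k == j then zt1 else zt0)
         (if k == i then zt_cos (H3_entry i j) else zt0)).
Definition ztr (M : zmat) := zt_add (mget M 0 0) (zt_add (mget M 1 1) (mget M 2 2)).
Definition zminor (M : zmat) i j k l :=
  zt_add (zt_mul (mget M i k) (mget M j l)) (zt_opp (zt_mul (mget M i l) (mget M j k))).
(** The sum of the principal minors of order 2, which is the trace on the second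
    exterior power. *)
Definition ze2 (M : zmat) :=
  zt_add (zt_add (zminor M 0 1 0 1) (zminor M 0 2 0 2)) (zminor M 1 2 1 2).
Definition zdet (M : zmat) :=
  zt_add (zt_add (zt_mul (mget M 0 0) (zminor M 1 2 1 2))
                 (zt_opp (zt_mul (mget M 0 1) (zminor M 1 2 0 2))))
         (zt_mul (mget M 0 2) (zminor M 1 2 0 1)).

Definition wordm (w : word) : zmat := foldr (fun i M => zmat_mul (zmat_refl i) M) zmat1 w.

Lemma mget_build f i j : (i < 3)%N -> (j < 3)%N -> mget (mbuild f) i j = f i j.
Proof. by case: i j => [|[|[|i]]] [|[|[|j]]]. Qed.

Definition mx_of (M : zmat) : 'M[algC]_3 := \matrix_(i, j) ct (mget M i j).

Lemma mx_of_mul A B : mx_of (zmat_mul A B) = mx_of A *m mx_of B.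
Proof.
apply/matrixP=> i j; rewrite !mxE mget_build // big_ord3 !mxE.
by rewrite !ctD !ctM.
Qed.

Lemma mx_of1 : mx_of zmat1 = 1%:M.
Proof.
apply/matrixP=> i j; rewrite !mxE mget_build // val_eqE.
by case: eqP => _; rewrite ?ct1 ?ct0.
Qed.

Lemma mx_of_inj (A B : zmat) : mx_of A = mx_of B ->
  forall i j, (i < 3)%N -> (j < 3)%N -> mget A i j = mget B i j.
Proof.
move=> e i j i3 j3; have /matrixP/(_ (Ordinal i3) (Ordinal j3)) := e.
by rewrite !mxE /= => /ct_inj.
Qed.

Lemma zt_cosE m : m \in [:: 1; 2; 3; 5]%N -> ct (zt_cos m) = 2 * cospi m.
Proof.
rewrite !inE => /or4P[] /eqP->; rewrite ?cospi1 ?cospi2 ?cospi3 -?/tau.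
- by rewrite /ct /zc /= mul0r addr0.
- exact: ct0.
- exact: ct1.
exact: ct_tau.
Qed.

Lemma mx_of_refl (i : 'I_3) : mx_of (zmat_refl i) = simple_refl H3_matrix i.
Proof.
apply/matrixP=> j k; rewrite !mxE mget_build // ctD; congr (_ + _).
  by rewrite val_eqE; case: eqP; rewrite ?ct1 ?ct0.
rewrite val_eqE; case: (k =P i) => _; rewrite ?mulr1 ?mulr0 ?ct0 // -zt_cosE //.
by case: i j => [[|[|[|i]]] Hi] [[|[|[|j]]] Hj].
Qed.

Lemma det_mx33 (R : fieldType) (M : 'M[R]_3) : \det M =
  M o0 o0 * (M o1 o1 * M o2 o2 - M o1 o2 * M o2 o1)
  - M o0 o1 * (M o1 o0 * M o2 o2 - M o1 o2 * M o2 o0)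
  + M o0 o2 * (M o1 o0 * M o2 o1 - M o1 o1 * M o2 o0).
Proof.
rewrite (expand_det_row _ o0) big_ord3 /cofactor !det_mx22 !mxE.
have e a (b : 'I_2) c : bump a b = c -> forall h : (c < 3)%N, forall h', lift (@Ordinal 3 a h') b = Ordinal h.
  by move=> <- h h'; apply/val_inj.
rewrite !(e 0 0 1 erefl isT) !(e 0 1 2 erefl isT) !(e 1 0 0 erefl isT).
rewrite !(e 1 1 2 erefl isT) !(e 2 0 0 erefl isT) !(e 2 1 1 erefl isT) /=.
rewrite -/o0 -/o1 -/o2.
by ring.
Qed.

Lemma ct_tr M : ct (ztr M) = \tr (ext_mx 1 (mx_of M)).
Proof. by rewrite mxtrace_ext1 !mxE !ctD. Qed.

Lemma ct_e2 M : ct (ze2 M) = \tr (ext_mx 2 (mx_of M)).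
Proof. by rewrite mxtrace_ext2 !mxE /ze2 /zminor !(ctD, ctN, ctM). Qed.

Lemma ct_det M : ct (zdet M) = \tr (ext_mx 3 (mx_of M)).
Proof. by rewrite mxtrace_ext3 det_mx33 !mxE /zdet /zminor !(ctD, ctN, ctM). Qed.

(** The pair (trace, determinant) and the number of elements of each conjugacy
    class: first the five classes of rotations, of orders 1, 2, 3, 5, 5, then
    their negatives. The identity has index 0. *)
Definition class_data : seq ((zt * zt) * nat) :=
  let z (a b : Z) : zt := (a, b) in
  let p := zt1 in let n := zt_opp zt1 in
  [:: ((z 3 0, p), 1%N); ((z (-1) 0, p), 15%N); ((z 0 0, p), 20%N);
      ((z 0 1, p), 12%N); ((z 1 (-1), p), 12%N);
      ((z (-3) 0, n), 1%N); ((z 1 0, n), 15%N); ((z 0 0, n), 20%N);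
      ((z 0 (-1), n), 12%N); ((z (-1) 1, n), 12%N)]%coqZ.

Definition word_key w := let M := wordm w in (ztr M, zdet M).
Definition class_index (w : word) : nat :=
  index (word_key w) [seq x.1 | x <- class_data].
Definition class_size c : nat := nth 0%N [seq x.2 | x <- class_data] c.

Definition tab (f : nat -> zt) : seq zt := [seq f c | c <- iota 0 10].
Definition tab_sub (T U : seq zt) :=
  tab (fun c => zt_add (nth zt0 T c) (zt_opp (nth zt0 U c))).
Definition tab_mul (T U : seq zt) := tab (fun c => zt_mul (nth zt0 T c) (nth zt0 U c)).
Definition tab_conj (T : seq zt) := tab (fun c => zt_conj (nth zt0 T c)).
Definition tab_one := tab (fun => zt1).
Definition tab_refl := tab (fun c => (nth (zt0, zt0) [seq x.1 | x <- class_data] c).1).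
Definition tab_sgn := tab (fun c => (nth (zt0, zt0) [seq x.1 | x <- class_data] c).2).

Definition zt_sum (s : seq zt) := foldr zt_add zt0 s.
(** The inner product of two class functions, multiplied by 120. There is no
    conjugation, as the values are real. *)
Definition tab_dot (T U : seq zt) : zt :=
  zt_sum (tab (fun c => zt_mul (zt_of_Z (Z.of_nat (class_size c)))
                               (zt_mul (nth zt0 T c) (nth zt0 U c)))).

Lemma nth_tab f c : (c < 10)%N -> nth zt0 (tab f) c = f c.
Proof. by move=> lec; rewrite (nth_map 0%N) ?size_iota // nth_iota. Qed.

Lemma class_index_lt : all (fun w => class_index w < 10)%N W_words.
Proof. by vm_compute. Qed.

Lemma class_index_count : perm_eq [seq class_index w | w <- W_words]
  (flatten [seq nseq (class_size c) c | c <- iota 0 10]).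
Proof. by vm_compute. Qed.

(** A real orthogonal matrix of determinant e satisfies e2 = e * trace; here this is
    checked on all elements. *)
Lemma word_e2 :
  all (fun w => ze2 (wordm w) == zt_mul (zdet (wordm w)) (ztr (wordm w))) W_words.
Proof. by vm_compute. Qed.

Lemma wordm_uniq : uniq [seq wordm w | w <- W_words].
Proof. by vm_compute. Qed.

Lemma word_keyE : all (fun w => word_key w ==
   (nth zt0 tab_refl (class_index w), nth zt0 tab_sgn (class_index w))) W_words.
Proof. by vm_compute. Qed.

Lemma wordm_mbuild w : exists f, wordm w = mbuild f.
Proof. by case: w => [|i w]; eexists; reflexivity. Qed.

Lemma wordm_inj u v : mx_of (wordm u) = mx_of (wordm v) -> wordm u = wordm v.
Proof.
have [f ->] := wordm_mbuild u; have [g ->] := wordm_mbuild v => /mx_of_inj e.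
apply/eq_in_map=> i; rewrite mem_iota => i3; apply/eq_in_map=> j.
by rewrite mem_iota => j3; have := e i j i3 j3; rewrite !mget_build.
Qed.

Lemma zc_nat n : zc (Z.of_nat n) = n%:R.
Proof. by rewrite /zc; case: n => //= n; rewrite SuccNat2Pos.id_succ. Qed.

Lemma ct_sum s : ct (zt_sum s) = \sum_(x <- s) ct x.
Proof. by elim: s => [|x s IHs]; rewrite ?big_nil ?ct0 // big_cons -IHs ctD. Qed.

Section Tables.

Variables (gT : finGroupType) (W : {group gT}) (s : 'I_3 -> gT).
Hypothesis genW : W :=: <<[set s i | i : 'I_3]>>%g.
Hypothesis relW : forall i j, ((s i * s j) ^+ H3_matrix i j = 1)%g.
Variable V : mx_representation algC W 3.
Hypothesis geomV : geometric_repr H3_matrix s V.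

(** The letters of a word are not bounded, whence the alternative. *)
Lemma V_word w : V (wordg s w) = mx_of (wordm w) \/ ~~ all (fun i => i < 3)%N w.
Proof.
elim: w => [|i w [IHw|IHw]] /=; first by left; rewrite repr_mx1 mx_of1.
  case: ltnP => [lt_i3|_]; last by right.
  left; rewrite repr_mxM ?(wordg_in genW) //; last first.
    by rewrite genW mem_gen // imset_f.
  by rewrite IHw mx_of_mul geomV -mx_of_refl inordK.
by right; rewrite negb_and IHw orbT.
Qed.

Lemma W_words_letters : all (all (fun i => i < 3)%N) W_words.
Proof. by vm_compute. Qed.

Lemma V_wordE w : w \in W_words -> V (wordg s w) = mx_of (wordm w).
Proof.
by move=> Ww; have [//|/negP[]] := V_word w; exact: (allP W_words_letters).
Qed.

Lemma wordg_uniq : uniq [seq wordg s w | w <- W_words].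
Proof.
rewrite map_inj_in_uniq; first exact: map_uniq wordm_uniq.
move=> u v Wu Wv e.
have em : wordm u = wordm v by apply: wordm_inj; rewrite -!V_wordE // e.
have := wordm_uniq; move/(uniqP [::]) => H.
rewrite -(nth_index [::] Wu) -(nth_index [::] Wv); congr (nth _ _ _).
apply: H; rewrite ?inE ?size_map ?index_mem //.
by rewrite !(nth_map [::]) ?index_mem // !nth_index.
Qed.

Lemma W_enum : perm_eq (enum W) [seq wordg s w | w <- W_words].
Proof.
apply: uniq_perm; [exact: enum_uniq | exact: wordg_uniq |] => x.
rewrite mem_enum; apply/idP/mapP=> [/(W_wordsP genW relW)[w Ww ->]|[w _ ->]].
  by exists w.
exact: (wordg_in genW).
Qed.

Lemma card_W : #|W| = 120%N.
Proof. by rewrite cardE (perm_size W_enum) size_map. Qed.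

(** Being constant on the classes, the function is given by its ten values. *)
Definition has_table (f : 'CF(W)) (T : seq zt) : Prop :=
  {in W_words, forall w, f (wordg s w) = ct (nth zt0 T (class_index w))}.

Lemma class_ltn w : w \in W_words -> (class_index w < 10)%N.
Proof. exact: (allP class_index_lt). Qed.

Lemma has_tableB f g T U : has_table f T -> has_table g U ->
  has_table (f - g) (tab_sub T U).
Proof.
by move=> Hf Hg w Ww; rewrite !cfunE Hf ?Hg // nth_tab ?class_ltn // ctD ctN.
Qed.

Lemma has_tableM f g T U : has_table f T -> has_table g U ->
  has_table (f * g) (tab_mul T U).
Proof. by move=> Hf Hg w Ww; rewrite cfunE Hf ?Hg // nth_tab ?class_ltn // ctM. Qed.

Lemma has_table1 : has_table 1 tab_one.
Proof.
by move=> w Ww; rewrite cfun1E (wordg_in genW) nth_tab ?class_ltn ?ct1.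
Qed.

Lemma has_table_aut (u : {rmorphism algC -> algC}) f T : u tau = 1 - tau ->
  has_table f T -> has_table (cfAut u f) (tab_conj T).
Proof.
move=> ut Hf w Ww; rewrite cfunE Hf // (ct_aut _ ut).
by rewrite nth_tab ?class_ltn.
Qed.

Lemma extC_word k w : w \in W_words -> extC V k (wordg s w) = \tr (ext_mx k (mx_of (wordm w))).
Proof. by move=> Ww; rewrite cfunE (wordg_in genW) mulr1n /= V_wordE. Qed.

Lemma has_table_ext0 : has_table (extC V 0) tab_one.
Proof.
by move=> w Ww; rewrite extC_word // mxtrace_ext0 nth_tab ?class_ltn ?ct1.
Qed.

Lemma has_table_ext1 : has_table (extC V 1) tab_refl.
Proof.
move=> w Ww; rewrite extC_word // -ct_tr.
by have /eqP[-> _] := allP word_keyE _ Ww.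
Qed.

Lemma has_table_ext3 : has_table (extC V 3) tab_sgn.
Proof.
move=> w Ww; rewrite extC_word // -ct_det.
by have /eqP[_ ->] := allP word_keyE _ Ww.
Qed.

Lemma has_table_ext2 : has_table (extC V 2) (tab_mul tab_sgn tab_refl).
Proof.
move=> w Ww; rewrite extC_word // -ct_e2 (eqP (allP word_e2 _ Ww)).
by rewrite nth_tab ?class_ltn //; have /eqP[-> ->] := allP word_keyE _ Ww.
Qed.

Lemma has_table_refl : has_table (cfRepr V) tab_refl.
Proof.
move=> w Ww; rewrite -has_table_ext1 // extC_word // mxtrace_ext1.
by rewrite cfunE (wordg_in genW) mulr1n V_wordE // /mxtrace big_ord3.
Qed.

Lemma cfdot_table f g T U : has_table f T -> has_table g U ->
  '[f, g] = 120%:R^-1 * ct (tab_dot T U).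
Proof.
move=> Hf Hg; rewrite cfdotE card_W; congr (_ * _).
pose h c := ct (zt_mul (nth zt0 T c) (nth zt0 U c)).
transitivity (\sum_(c <- [seq class_index w | w <- W_words]) h c).
  rewrite big_map -big_enum (perm_big _ W_enum) big_map /=.
  rewrite big_seq [RHS]big_seq; apply: eq_bigr => w Ww.
  by rewrite Hf // Hg // ct_real -ctM.
rewrite (perm_big _ class_index_count) big_flatten big_map ct_sum big_map.
apply: eq_bigr => c _; rewrite big_nseq iter_addr_0 ctM ctZ zc_nat.
by rewrite mulr_natl.
Qed.

End Tables.

(** * Coinvariant algebra and irreducible characters *)

Section ZtPolynomials.

Fixpoint pz_add (p q : seq zt) : seq zt :=
  match p, q with
  | [::], _ => q
  | _, [::] => p
  | x :: p', y :: q' => zt_add x y :: pz_add p' q'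
  end.
Fixpoint pz_mul (p q : seq zt) : seq zt :=
  if p is x :: p' then pz_add (map (zt_mul x) q) (zt0 :: pz_mul p' q) else [::].

(** A list of coefficients, by increasing degree, as a polynomial. *)
Definition pc (p : seq zt) : {poly algC} := Poly (map ct p).

Lemma pcE p n : (pc p)`_n = ct (nth zt0 p n).
Proof.
rewrite coef_Poly; have [ltnp|lepn] := ltnP n (size p); first exact: nth_map.
by rewrite !nth_default ?size_map ?ct0.
Qed.

Lemma pc_cons x p : pc (x :: p) = (ct x)%:P + pc p * 'X.
Proof. by rewrite /pc /= cons_poly_def addrC. Qed.

Lemma pc_add p q : pc (pz_add p q) = pc p + pc q.
Proof.
elim: p q => [|x p IHp] [|y q] /=; rewrite ?add0r ?addr0 //.
by rewrite !pc_cons IHp ctD polyCD; ring.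
Qed.

Lemma pc_mul p q : pc (pz_mul p q) = pc p * pc q.
Proof.
elim: p => [|x p IHp] /=; first by rewrite mul0r.
rewrite pc_add !pc_cons IHp ct0 mulrDl; congr (_ + _); last by ring.
by elim: q {IHp} => [|y q IHq] /=; rewrite ?mulr0 // !pc_cons IHq ctM polyCM; ring.
Qed.

End ZtPolynomials.

(** The product (1 - q ^ 2) (1 - q ^ 6) (1 - q ^ 10). *)
Definition degrees_poly : seq Z :=
  [:: 1; 0; -1; 0; 0; 0; -1; 0; 1; 0; -1; 0; 1; 0; 0; 0; 1; 0; -1]%coqZ.

(** The polynomial det (1 - q w) for w in the class c. *)
Definition class_charpoly c : seq zt :=
  let a := nth zt0 tab_refl c in let e := nth zt0 tab_sgn c in
  [:: zt1; zt_opp a; zt_mul e a; zt_opp e].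

(** Long division of the power series v by 1 - a q + e a q ^ 2 - e q ^ 3, the last
    three quotient coefficients being x, y, z. *)
Fixpoint pz_quo (a e : zt) (v : seq Z) (x y z : zt) : seq zt :=
  if v is k :: v' then
    let x' := zt_add (zt_add (zt_of_Z k) (zt_mul a x))
      (zt_add (zt_opp (zt_mul (zt_mul e a) y)) (zt_mul e z)) in
    x' :: pz_quo a e v' x' x y
  else [::].

(** The division is exact, and the quotient has degree at most 15. *)
Definition coinv_row c : seq zt :=
  take 16 (pz_quo (nth zt0 tab_refl c) (nth zt0 tab_sgn c) degrees_poly zt0 zt0 zt0).
Definition coinv_rows : seq (seq zt) := Eval vm_compute in map coinv_row (iota 0 10).

Definition coinv_tab n : seq zt := tab (fun c => nth zt0 (nth [::] coinv_rows c) n).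

Lemma coinv_rows_mul : all (fun c => pz_mul (nth [::] coinv_rows c) (class_charpoly c)
    == map zt_of_Z degrees_poly) (iota 0 10).
Proof. by vm_compute. Qed.

Lemma coinv_tab_large n : (16 <= n)%N -> coinv_tab n = tab (fun=> zt0).
Proof.
move=> le16n; apply/eq_in_map=> c; rewrite mem_iota => /= c10.
rewrite nth_default // (leq_trans _ le16n) //.
by do 10?[case: c c10 => [|c] c10 //].
Qed.

(** The trivial character occurs once in degree 0 and nowhere else. *)
Lemma coinv_tab_triv n :
  tab_dot (coinv_tab n) tab_one = if n == 0%N then (Zpos 120, Z0)%coqZ else zt0.
Proof.
have [le16n|] := leqP 16 n; last first.
  by do 16?[case: n => [|n] //].
by rewrite coinv_tab_large //; case: n le16n.
Qed.

(** The rows are the characters with dimension and fake degree 1_0, 3_1, 5_2, 4_3,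
    3_3, 4_4, 5_5, 3_6, 3_8, 1_15, in this order. *)
Definition char_table : seq (seq zt) := Eval vm_compute in
  let five := coinv_tab 2 in
  let refl' := tab_conj tab_refl in
  let four := tab_sub (coinv_tab 3) refl' in
  [:: tab_one; tab_refl; five; four; refl'; tab_mul four tab_sgn;
      tab_mul five tab_sgn; tab_mul tab_refl tab_sgn; tab_mul refl' tab_sgn; tab_sgn].

Definition chi_tab k : seq zt := nth [::] char_table k.

Lemma char_table_ortho : all (fun j => all (fun k =>
  tab_dot (chi_tab j) (chi_tab k) == if j == k then (Zpos 120, Z0)%coqZ else zt0)
  (iota 0 10)) (iota 0 10).
Proof. by vm_compute. Qed.

Section Characters.

Variables (gT : finGroupType) (W : {group gT}) (s : 'I_3 -> gT).
Hypothesis genW : W :=: <<[set s i | i : 'I_3]>>%g.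
Hypothesis relW : forall i j, ((s i * s j) ^+ H3_matrix i j = 1)%g.
Variable V : mx_representation algC W 3.
Hypothesis geomV : geometric_repr H3_matrix s V.

Notation has_table := (@has_table gT W s).
Notation cfdot_table := (cfdot_table genW relW geomV).

Lemma has_table_inj (f g : 'CF(W)) T : has_table f T -> has_table g T -> f = g.
Proof.
move=> Hf Hg; apply/cfun_inP=> x /(W_wordsP genW relW)[w Ww ->].
by rewrite Hf ?Hg.
Qed.

Lemma molien_table n w : w \in W_words ->
  \sum_(i < n.+1) zc (nth Z0 degrees_poly i) * symC V (n - i) (wordg s w)
    = ct (nth zt0 (coinv_tab n) (class_index w)).
Proof.
move=> Ww; have c10 := class_ltn Ww; rewrite nth_tab //.
set c := class_index w in c10 *; rewrite -pcE.
have nthv i : zc (nth Z0 degrees_poly i) = (pc (map zt_of_Z degrees_poly))`_i.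
  rewrite pcE; have [lti|lei] := ltnP i (size degrees_poly).
    by rewrite (nth_map Z0) // ctZ.
  by rewrite !nth_default ?size_map // ct0.
under eq_bigr => i _ do rewrite nthv.
apply: (@molien_coef _ _ V _ _ (pc (nth [::] coinv_rows c)) n (wordg_in genW w)).
have /eqP <- : pz_mul (nth [::] coinv_rows c) (class_charpoly c)
    == map zt_of_Z degrees_poly.
  by apply: (allP coinv_rows_mul); rewrite mem_iota.
rewrite pc_mul; congr (_ * _).
rewrite !big_ord_recl big_ord0 /= (has_table_ext0 genW geomV) //.
rewrite (has_table_ext1 genW geomV) // (has_table_ext2 genW geomV) //.
rewrite (has_table_ext3 genW geomV) // -/c /class_charpoly !pc_cons /=.
rewrite /tab_one !nth_tab // !ctN ctM /bump /= ct1 /pc /=.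
by rewrite !(polyCM, polyCN); ring.
Qed.

(** The coefficient of q ^ n in the product of the graded character of S(V) with
    (1 - q ^ 2) (1 - q ^ 6) (1 - q ^ 10). *)
Definition molien_cf n : 'CF(W) :=
  \sum_(i < n.+1) zc (nth Z0 degrees_poly i) *: symC V (n - i).

Lemma molien_cf_table n : has_table (molien_cf n) (coinv_tab n).
Proof.
move=> w Ww; rewrite /molien_cf sum_cfunE -molien_table //.
by apply: eq_bigr => i _; rewrite cfunE.
Qed.

(** The Hilbert series of the invariants is
    1 / ((1 - q ^ 2) (1 - q ^ 6) (1 - q ^ 10)): its coefficients are multiplicities
    of the trivial character. *)
Lemma inv_dim_series n :
  \sum_(i < n.+1) zc (nth Z0 degrees_poly i) * (inv_dim V (n - i))%:R = (n == 0%N)%:R.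
Proof.
under eq_bigr => i _ do rewrite rank_rfix -cfdotZl.
rewrite -cfdot_suml (cfdot_table (molien_cf_table n) (has_table1 genW)).
rewrite coinv_tab_triv; case: (n == 0%N); last by rewrite ct0 mulr0.
by rewrite /ct /= /zc mul0r addr0 mulVf // pnatr_eq0.
Qed.

(** By freeness S = C * H as graded characters, H being the Hilbert series of the
    invariants, and D * H = 1 for D = (1 - q ^ 2) (1 - q ^ 6) (1 - q ^ 10); hence
    C = D * S. The series are truncated at degree n. *)
Lemma coinvC_molien n : coinvC V n = molien_cf n.
Proof.
apply/cfunP=> x; rewrite /molien_cf sum_cfunE.
pose v := \poly_(i < n.+1) zc (nth Z0 degrees_poly i).
pose h := \poly_(i < n.+1) ((inv_dim V i)%:R : algC).
pose c := \poly_(i < n.+1) coinvC V i x.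
have Hs m : (m <= n)%N -> symC V m x = (c * h)`_m.
  move=> lemn; have refl_s i : reflection (V (s i)).
    by rewrite geomV; exact: simple_refl_reflection.
  rewrite /symC (sym_char genW refl_s) sum_cfunE coefM; apply: eq_bigr => k _.
  have lekn : (k < n.+1)%N  by apply: leq_trans (ltn_ord k) _; rewrite ltnS.
  have ltmk : (m - k < n.+1)%N by rewrite ltnS (leq_trans (leq_subr _ _) lemn).
  rewrite cfunE !coef_poly ltmk lekn.
  exact: mulrC.
transitivity ((v * (c * h))`_n); last first.
  rewrite coefM; apply: eq_bigr => i _; rewrite cfunE coef_poly ltn_ord.
  by rewrite Hs ?leq_subr.
rewrite mulrCA mulrC coefM big_ord_recl subn0 big1 ?addr0 => [|i _].
  rewrite coefM big_ord1 /= !coef_poly ltnSn /=.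
  have := inv_dim_series 0; rewrite big_ord1 => ->.
  by rewrite mul1r.
rewrite [X in X * _](_ : _ = 0) ?mul0r //.
have ltin : (lift ord0 i < n.+1)%N by exact: ltn_ord.
rewrite -[RHS](_ : (lift ord0 i == 0%N :> nat)%:R = 0) // -inv_dim_series coefM.
apply: eq_bigr => j _; rewrite !coef_poly.
have lejn : (j < n.+1)%N by rewrite (leq_trans (ltn_ord j)).
by rewrite lejn ltnS (leq_trans (leq_subr _ _)) // -ltnS.
Qed.

Lemma coinv_table n : has_table (coinvC V n) (coinv_tab n).
Proof. by rewrite coinvC_molien; exact: molien_cf_table. Qed.

Lemma has_table_at1 (f : 'CF(W)) T : has_table f T -> f 1%g = ct (nth zt0 T 0).
Proof. by move=> Hf; have := Hf [::] isT; rewrite /=. Qed.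

(** A virtual character of norm 1 is irreducible up to sign. *)
Lemma irr_of_table (f : 'CF(W)) T : f \in 'Z[irr W]%g -> has_table f T ->
  tab_dot T T = (Zpos 120, Z0)%coqZ -> 0 < ct (nth zt0 T 0) ->
  exists i, has_table 'chi_i T.
Proof.
move=> Zf Hf norm1 pos1; have n1 : '[f] = 1.
  rewrite (cfdot_table Hf Hf) norm1.
  by rewrite /ct /= /zc mul0r addr0 mulVf // pnatr_eq0.
have [[] [i fE]] := vchar_norm1P Zf n1; last first.
  by exists i; rewrite expr0 scale1r in fE; rewrite -fE.
move: pos1; rewrite -(has_table_at1 Hf) fE expr1 scaleN1r cfunE oppr_gt0.
by rewrite lt_gtF // irr1_gt0.
Qed.

Lemma irr_table (k : 'I_10) : exists i : Iirr W, has_table 'chi_i (chi_tab k).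
Proof.
have [u ut] := tau_aut.
have ZV : cfRepr V \in 'Z[irr W]%g by rewrite char_vchar ?cfRepr_char.
have Zc n : coinvC V n \in 'Z[irr W]%g by rewrite char_vchar ?cfRepr_char.
have ZS : extC V 3 \in 'Z[irr W]%g by rewrite char_vchar ?cfRepr_char.
have ZV' : cfAut u (cfRepr V) \in 'Z[irr W]%g by exact: cfAut_vchar.
have Z4 : coinvC V 3 - cfAut u (cfRepr V) \in 'Z[irr W]%g by rewrite rpredB.
have TV := has_table_refl genW geomV.
have TV' := has_table_aut ut TV.
have T4 := has_tableB (coinv_table 3) TV'.
have TS := has_table_ext3 genW geomV.
have Hpos n : 0 < ct (Zpos n, Z0) by rewrite /ct /= /zc mul0r addr0 ltr0z (ltz_nat 0); exact/ssrnat.ltP/Pos2Nat.is_pos.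
have irrk f T : f \in 'Z[irr W]%g -> has_table f T -> T = chi_tab k ->
    exists i, has_table 'chi_i (chi_tab k).
  move=> Zf Hf eT; apply: irr_of_table Zf _ _ _; first by rewrite -eT.
    have /allP/(_ k) := char_table_ortho; rewrite mem_iota ltn_ord => /(_ isT).
    by move/allP/(_ k); rewrite mem_iota ltn_ord => /(_ isT)/eqP->; rewrite eqxx.
  by case: k {eT} => -[|[|[|[|[|[|[|[|[|[|k]]]]]]]]]] Hk //=.
have M (f g : 'CF(W)) : f \in 'Z[irr W]%g -> g \in 'Z[irr W]%g -> f * g \in 'Z[irr W]%g.
  by move=> Zf Zg; rewrite rpredM.
case: k irrk => -[|[|[|[|[|[|[|[|[|[|k]]]]]]]]]] Hk // irrk.
- by apply: (irrk 1 _ _ (has_table1 genW)); rewrite ?cfun1_vchar //; vm_compute.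
- by apply: (irrk _ _ ZV TV); vm_compute.
- by apply: (irrk _ _ (Zc 2) (coinv_table 2)); vm_compute.
- by apply: (irrk _ _ Z4 T4); vm_compute.
- by apply: (irrk _ _ ZV' TV'); vm_compute.
- by apply: (irrk _ _ (M _ _ Z4 ZS) (has_tableM T4 TS)); vm_compute.
- by apply: (irrk _ _ (M _ _ (Zc 2) ZS) (has_tableM (coinv_table 2) TS)); vm_compute.
- by apply: (irrk _ _ (M _ _ ZV ZS) (has_tableM TV TS)); vm_compute.
- by apply: (irrk _ _ (M _ _ ZV' ZS) (has_tableM TV' TS)); vm_compute.
by apply: (irrk _ _ ZS TS); vm_compute.
Qed.

End Characters.

(** * Triangular systems *)

Section Triangular.

Variables (K : fieldType) (n : nat) (b : 'I_n -> K).
Hypothesis nz_b : forall z, b z != 0.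

Definition triangular (p : 'I_n -> 'I_n -> K) :=
  (forall z, p z z = b z) /\ (forall z x : 'I_n, (z < x)%N -> p z x = 0).

(** Downward induction on z: in the equation with y = z, the terms below z vanish by
    triangularity and those above are known. This gives l z * p z x, then l z from
    the prescribed diagonal, then the row p z. *)
Lemma gram_unique (p p' : 'I_n -> 'I_n -> K) (l l' : 'I_n -> K) :
    triangular p -> triangular p' -> (forall z, l z != 0) ->
    (forall x y, \sum_z l z * p z x * p z y = \sum_z l' z * p' z x * p' z y) ->
  forall z, l z = l' z /\ p z =1 p' z.
Proof.
move=> [pd pt] [pd' pt'] nz_l E z.
have [m] := ubnP (n - z); elim: m z => // m IHm z; rewrite ltnS => lezm.
have IH (k : 'I_n) : (z < k)%N -> l k = l' k /\ p k =1 p' k.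
  by move=> lt_zk; apply: IHm; apply: leq_trans lezm; rewrite ltn_sub2l.
have Ex x : l z * p z x = l' z * p' z x.
  have := E x z; rewrite (bigD1 z) //= [RHS](bigD1 z) //= pd pd'.
  rewrite [X in _ + X](_ : _ = \sum_(k | k != z) l' k * p' k x * p' k z).
    by move/addIr/(mulIf (nz_b z)).
  apply: eq_bigr => k nkz; have [lt_zk|lt_kz|/val_inj ekz] := ltngtP z k.
  - by have [-> ek] := IH k lt_zk; rewrite !ek.
  - by rewrite (pt _ _ lt_kz) (pt' _ _ lt_kz) !mulr0.
  by rewrite ekz eqxx in nkz.
have El : l z = l' z.
  by apply: (mulIf (nz_b z)); have := Ex z; rewrite pd pd'.
by split=> // x; apply: (mulfI (nz_l z)); rewrite Ex -El.
Qed.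

Lemma triangular_solve (p : 'I_n -> 'I_n -> K) (k k' : 'I_n -> K) :
    triangular p -> (forall y, \sum_x k x * p x y = \sum_x k' x * p x y) ->
  k =1 k'.
Proof.
move=> [pd pt] E z; have [m] := ubnP (n - z); elim: m z => // m IHm z.
rewrite ltnS => lezm; have := E z; rewrite (bigD1 z) //= [RHS](bigD1 z) //= pd.
rewrite [X in _ + X](_ : _ = \sum_(x | x != z) k' x * p x z).
  by move/addIr/(mulIf (nz_b z)).
apply: eq_bigr => x nxz; have [lt_zx|lt_xz|/val_inj exz] := ltngtP z x.
- by rewrite IHm // (leq_trans _ lezm) // ltn_sub2l.
- by rewrite (pt _ _ lt_xz) !mulr0.
by rewrite exz eqxx in nxz.
Qed.

End Triangular.

(** * Polynomials in q with integer coefficients *)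

Section IntegerPolynomials.

Fixpoint lz_add (p r : seq Z) : seq Z :=
  match p, r with
  | [::], _ => r
  | _, [::] => p
  | x :: p', y :: r' => Z.add x y :: lz_add p' r'
  end.
Definition lz_scale (a : Z) (p : seq Z) := map (Z.mul a) p.
Fixpoint lz_mul (p r : seq Z) : seq Z :=
  if p is x :: p' then lz_add (lz_scale x r) (Z0 :: lz_mul p' r) else [::].
Definition lz_mono n : seq Z := rcons (nseq n Z0) 1%coqZ.
Definition lz_sum (s : seq (seq Z)) := foldr lz_add [::] s.
(** Equality up to trailing zeros. *)
Definition lz_eq (p r : seq Z) : bool :=
  all (Z.eqb 0%coqZ) (lz_add p (lz_scale (-1)%coqZ r)).

Definition zr (a : Z) : rat := (int_of_Z a)%:~R.
(** A list of integer coefficients, by increasing degree, as an element of Q(q). *)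
Definition lq (p : seq Z) : Qq := tofrac (Poly (map zr p)).

Lemma lq_cons a p : lq (a :: p) = (int_of_Z a)%:~R + q * lq p.
Proof.
rewrite /lq /= cons_poly_def tofracD tofracM addrC mulrC; congr (_ + _).
by rewrite /zr !rmorph_int.
Qed.

Lemma lq_nil : lq [::] = 0. Proof. exact: tofrac0. Qed.

Lemma lq_add p r : lq (lz_add p r) = lq p + lq r.
Proof.
elim: p r => [|x p IHp] [|y r] /=; rewrite ?lq_nil ?add0r ?addr0 //.
by rewrite !lq_cons IHp -[Z.add x y]/(x + y) !rmorphD /=; ring.
Qed.

Lemma lq_scale a p : lq (lz_scale a p) = (int_of_Z a)%:~R * lq p.
Proof.
elim: p => [|x p IHp] /=; first by rewrite lq_nil mulr0.
by rewrite !lq_cons IHp -[Z.mul a x]/(a * x) !rmorphM /=; ring.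
Qed.

Lemma lq_mul p r : lq (lz_mul p r) = lq p * lq r.
Proof.
elim: p => [|x p IHp] /=; first by rewrite lq_nil mul0r.
by rewrite lq_add lq_scale !lq_cons IHp /=; ring.
Qed.

Lemma lq_mono n : lq (lz_mono n) = q ^+ n.
Proof.
elim: n => [|n IHn]; first by rewrite lq_cons lq_nil mulr0 addr0 expr0.
by rewrite lq_cons IHn add0r exprS.
Qed.

Lemma lq_sum (s : seq (seq Z)) : lq (lz_sum s) = \sum_(p <- s) lq p.
Proof. by elim: s => [|p s IHs]; rewrite ?big_nil ?lq_nil // big_cons -IHs lq_add. Qed.

Lemma lq_eq p r : lz_eq p r -> lq p = lq r.
Proof.
rewrite /lz_eq => H; apply/eqP; rewrite -subr_eq0.
have -> : lq p - lq r = lq (lz_add p (lz_scale (-1)%coqZ r)).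
  by rewrite lq_add lq_scale mulN1r.
elim: (lz_add _ _) H => [|x s IHs]; first by rewrite lq_nil.
case/andP=> /Z.eqb_eq <- /IHs/eqP e.
by rewrite lq_cons e mulr0 addr0.
Qed.

End IntegerPolynomials.

Lemma q_neq0 : q != 0.
Proof. by rewrite tofrac_eq0 polyX_eq0. Qed.

Lemma q_exp_neq1 n : (0 < n)%N -> q ^+ n - 1 != 0.
Proof.
move=> n_gt0; rewrite -tofracXn -tofrac1 -tofracB tofrac_eq0.
by rewrite -size_poly_eq0 size_XnsubC.
Qed.

Lemma q_expz (t a b : nat) : q ^ (a%:Z * t%:Z - b%:Z) = (q ^+ t) ^+ a / q ^+ b.
Proof.
rewrite expfzDr ?q_neq0 // -exprM mulnC -invr_expz; congr (_ / _).
Qed.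

(** * Graded multiplicities and fake degrees *)

Section GradedMultiplicities.

Variables (gT : finGroupType) (W : {group gT}).

Lemma ratr_mult (f : 'CF(W)) i : f \is a character -> ratr (mult f i) = '[f, 'chi_i] :> algC.
Proof. by move=> Nf; rewrite /mult ratr_nat truncnK // Cnat_cfdot_char_irr. Qed.

Lemma ratr_zr a : ratr (zr a) = zc a :> algC.
Proof. by rewrite /zr ratr_int. Qed.

(** The series of multiplicities is l / v as soon as v times it is l; the
    multiplicities are computed as inner products of characters. *)
Lemma gclass_expand (f : nat -> 'CF(W)) i (l v : seq Z) :
    (forall n, f n \is a character) -> zr (nth Z0 v 0) != 0 ->
    (forall n, \sum_(j < n.+1) zc (nth Z0 v j) * '[f (n - j)%N, 'chi_i]
               = zc (nth Z0 l n)) ->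
  gclass f i = lq l / lq v.
Proof.
move=> Nf nz_v Hl; rewrite ffunE; apply: gsumE.
have nthE (s : seq Z) n : (Poly (map zr s))`_n = zr (nth Z0 s n).
  rewrite coef_Poly; have [lts|les] := ltnP n (size s); first exact: nth_map.
  by rewrite !nth_default ?size_map.
exists (Poly (map zr l)), (Poly (map zr v)); split=> [||n]; rewrite ?nthE //.
apply: (fmorph_inj (@ratr algC)); rewrite [LHS]ratr_zr -Hl rmorph_sum /=.
by apply: eq_bigr => j _; rewrite rmorphM /= nthE ratr_zr ratr_mult.
Qed.

Lemma pairing_chi (x : Kq W) i : pairing x (kclass 'chi_i) = x i.
Proof.
rewrite /pairing (bigD1 i) //= big1 ?addr0 => [|j nji]; rewrite ffunE /mult cfdot_irr.
  by rewrite eqxx truncn1 /= tofrac1 mulr1.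
by rewrite eq_sym (negPf nji) truncn0 /= tofrac0 mulr0.
Qed.

End GradedMultiplicities.

(** Multiplicities of the character of index k in degrees 0 to 15; beyond, the
    coinvariant algebra vanishes. *)
Definition mult_list (T : nat -> seq zt) k : seq Z :=
  [seq Z.div (tab_dot (T n) (chi_tab k)).1 120%coqZ | n <- iota 0 16].

(** The degree n part of C(q) * chi_j * sgn. *)
Definition omega_tab j n := tab_mul (tab_mul (coinv_tab n) (chi_tab j)) tab_sgn.
Definition ext_tab i := nth [::] [:: tab_one; tab_refl; tab_mul tab_sgn tab_refl; tab_sgn] i.
Definition coinv_ext_tab i n := tab_mul (coinv_tab n) (ext_tab i).

Definition coinv_mults : seq (seq Z) :=
  Eval vm_compute in [seq mult_list coinv_tab k | k <- iota 0 10].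
Definition omega : seq (seq (seq Z)) :=
  Eval vm_compute in [seq [seq mult_list (omega_tab j) k | k <- iota 0 10] | j <- iota 0 10].
Definition coinv_ext_mults : seq (seq (seq Z)) :=
  Eval vm_compute in [seq [seq mult_list (coinv_ext_tab i) k | k <- iota 0 10] | i <- iota 0 4].

(** Exactness of the division by 120 in [mult_list]. Degree 16 stands for all
    higher degrees. *)
Definition mult_ok (T : nat -> seq zt) (l : seq Z) k : bool :=
  all (fun n => tab_dot (T n) (chi_tab k) == (Z.mul 120%coqZ (nth Z0 l n), Z0)) (iota 0 17)
  && (size l <= 16)%N.

Lemma coinv_mults_ok : all (fun k => mult_ok coinv_tab (nth [::] coinv_mults k) k) (iota 0 10).
Proof. by vm_compute. Qed.

Lemma omega_ok : all (fun j => all (fun k =>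
  mult_ok (omega_tab j) (nth [::] (nth [::] omega j) k) k) (iota 0 10)) (iota 0 10).
Proof. by vm_compute. Qed.

Lemma coinv_ext_ok : all (fun i => all (fun k =>
  mult_ok (coinv_ext_tab i) (nth [::] (nth [::] coinv_ext_mults i) k) k) (iota 0 10)) (iota 0 4).
Proof. by vm_compute. Qed.

Lemma mult_okP T l k : mult_ok T l k -> (forall n, (16 <= n)%N -> T n = T 16%N) ->
  forall n, tab_dot (T n) (chi_tab k) = (Z.mul 120%coqZ (nth Z0 l n), Z0).
Proof.
case/andP=> /allP ok sizel T16 n; have [le16n|ltn16] := leqP 16 n; last first.
  by apply/eqP/ok; rewrite mem_iota /= (ltn_trans ltn16).
rewrite T16 // (eqP (ok 16%N isT)).
by rewrite !nth_default // (leq_trans sizel).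
Qed.

Definition fake_degrees : seq nat := [:: 0; 1; 2; 3; 3; 4; 5; 6; 8; 15]%N.
Definition dims : seq nat := [:: 1; 3; 5; 4; 3; 4; 5; 3; 3; 1]%N.

Lemma coinv_mults_fake : all (fun k =>
  let l := nth [::] coinv_mults k in let b := nth 0%N fake_degrees k in
  (nth Z0 l b != Z0) && all (fun n => nth Z0 l n == Z0) (iota 0 b)) (iota 0 10).
Proof. by vm_compute. Qed.

Lemma dims_ok : all (fun k => nth zt0 (chi_tab k) 0 == zt_of_Z (Z.of_nat (nth 0%N dims k))) (iota 0 10).
Proof. by vm_compute. Qed.

Lemma ct_div120 a : 120%:R^-1 * ct (Z.mul 120%coqZ a, Z0) = zc a.
Proof. by rewrite /ct zcM /= /zc mul0r addr0 mulKf // pnatr_eq0. Qed.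

Section Irr.

Variables (gT : finGroupType) (W : {group gT}) (s : 'I_3 -> gT).
Hypothesis genW : W :=: <<[set s i | i : 'I_3]>>%g.
Hypothesis relW : forall i j, ((s i * s j) ^+ H3_matrix i j = 1)%g.
Variable V : mx_representation algC W 3.
Hypothesis geomV : geometric_repr H3_matrix s V.

Notation has_table := (@has_table gT W s).
Notation cfdot_table := (cfdot_table genW relW geomV).

Variable rho : 'I_10 -> Iirr W.
Hypothesis rhoP : forall k, has_table 'chi_(rho k) (chi_tab k).

Lemma mem_iota10 (k : 'I_10) : val k \in iota 0 10.
Proof. by rewrite mem_iota; exact: ltn_ord. Qed.

Lemma rho_inj : injective rho.
Proof.
move=> j k e; apply/val_inj/eqP; apply: contraT => njk.
have := cfdot_irr (rho j) (rho k); rewrite {2}e eqxx (cfdot_table (rhoP j) (rhoP k)).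
have /allP/(_ _ (mem_iota10 j))/allP/(_ _ (mem_iota10 k))/eqP-> := char_table_ortho.
by rewrite (negPf njk) ct0 mulr0 => /eqP; rewrite eq_sym oner_eq0.
Qed.

Lemma rho_degree k : 'chi_(rho k) 1%g = (nth 0%N dims k)%:R.
Proof.
rewrite (has_table_at1 (rhoP k)) (eqP (allP dims_ok _ (mem_iota10 k))) ctZ.
exact: zc_nat.
Qed.

(** The squares of the ten degrees already add up to 120. *)
Lemma rho_onto i : exists k, i = rho k.
Proof.
have [/codomP//|ni] := boolP (i \in codom rho).
have := irr_sum_square W; rewrite (card_W genW relW geomV).
rewrite (bigID (mem [set rho k | k : 'I_10])) /=.
rewrite big_imset /=; last by move=> j k _ _; exact: rho_inj.
under eq_bigr => k _ do rewrite rho_degree.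
rewrite !big_ord_recl big_ord0 /= => E.
have {E}/eqP : \sum_(j | j \notin [set rho k | k : 'I_10]) 'chi[W]_j 1%g ^+ 2 = 0.
  apply: (addrI (120%:R : algC)); rewrite addr0 -[RHS]E.
  by ring.
rewrite psumr_eq0; last first.
  by move=> j _; rewrite exprn_ge0 // char1_ge0 // irr_char.
move/allP/(_ i); rewrite mem_index_enum => /(_ isT).
have -> : i \notin [set rho k | k : 'I_10].
  by apply: contra ni => /imsetP[k _ ->]; exact: codom_f.
by rewrite expf_eq0 (negPf (irr1_neq0 i)).
Qed.

Lemma cfdot_coinv n k :
  '[coinvC V n, 'chi_(rho k)] = zc (nth Z0 (nth [::] coinv_mults k) n).
Proof.
rewrite (cfdot_table (coinv_table genW relW geomV n) (rhoP k)).
have ok := allP coinv_mults_ok _ (mem_iota10 k).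
rewrite (mult_okP ok) => [|m le16]; last by rewrite !coinv_tab_large.
exact: ct_div120.
Qed.

Lemma ext_table i : (i < 4)%N -> has_table (extC V i) (ext_tab i).
Proof.
case: i => [|[|[|[|i]]]] // _; first exact: (has_table_ext0 genW geomV).
- exact: (has_table_ext1 genW geomV).
- exact: (has_table_ext2 genW geomV).
exact: (has_table_ext3 genW geomV).
Qed.

Lemma cfdot_omega (j : 'I_10) n (k : 'I_10) :
  '[coinvC V n * 'chi_(rho j) * sgnC V, 'chi_(rho k)]
    = zc (nth Z0 (nth [::] (nth [::] omega j) k) n).
Proof.
have TS := has_table_ext3 genW geomV.
have T := has_tableM (has_tableM (coinv_table genW relW geomV n) (rhoP j)) TS.
rewrite (cfdot_table T (rhoP k)).
have ok := allP (allP omega_ok _ (mem_iota10 j)) _ (mem_iota10 k).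
have := mult_okP ok; rewrite /omega_tab => -> => [|m le16]; last by rewrite !coinv_tab_large.
exact: ct_div120.
Qed.

Lemma cfdot_coinv_ext i n k : (i < 4)%N ->
  '[coinvC V n * extC V i, 'chi_(rho k)]
    = zc (nth Z0 (nth [::] (nth [::] coinv_ext_mults i) k) n).
Proof.
move=> i4; have T := has_tableM (coinv_table genW relW geomV n) (ext_table i4).
have mi : i \in iota 0 4 by rewrite mem_iota.
rewrite (cfdot_table T (rhoP k)); have ok := allP (allP coinv_ext_ok _ mi) _ (mem_iota10 k).
have := mult_okP ok; rewrite /coinv_ext_tab => -> => [|m le16].
  exact: ct_div120.
by rewrite !coinv_tab_large.
Qed.

Lemma gclass_omega j k :
  gclass (fun n => coinvC V n * 'chi_(rho j) * sgnC V) (rho k)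
    = lq (nth [::] (nth [::] omega j) k).
Proof.
rewrite (@gclass_expand _ _ _ _ (nth [::] (nth [::] omega j) k) [:: 1%coqZ]) => [|n||n].
- by rewrite lq_cons lq_nil mulr0 addr0 divr1.
- by rewrite !rpredM ?cfRepr_char ?irr_char.
- by [].
rewrite big_ord_recl /= subn0 big1 ?addr0 => [|i _]; first by rewrite mul1r cfdot_omega.
by rewrite /= nth_nil mul0r.
Qed.

(** Since C = D * S for D = (1 - q ^ 2) (1 - q ^ 6) (1 - q ^ 10), the graded
    multiplicity in S times an exterior power is that in C, divided by D. *)
Lemma gclass_sym_ext i k : (i < 4)%N ->
  gclass (fun n => symC V n * extC V i) (rho k)
    = lq (nth [::] (nth [::] coinv_ext_mults i) k) / lq degrees_poly.
Proof.
move=> i4; apply: gclass_expand => [n||n]; first by rewrite rpredM ?cfRepr_char.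
  by [].
rewrite -(cfdot_coinv_ext _ _ i4) (coinvC_molien genW relW geomV).
rewrite /molien_cf mulr_suml cfdot_suml; apply: eq_bigr => j _.
by rewrite -scalerAl cfdotZl.
Qed.

Lemma sym_coinv_dot n k : '[symC V n, 'chi_(rho k)] =
  \sum_(j < n.+1) (inv_dim V (n - j))%:R * '[coinvC V j, 'chi_(rho k)].
Proof.
have refl_s i : reflection (V (s i)) by rewrite geomV; exact: simple_refl_reflection.
rewrite {1}/symC (sym_char genW refl_s) cfdot_suml.
by apply: eq_bigr => j _; rewrite cfdotZl.
Qed.

(** By freeness, the lowest degree of an irreducible character in S(V) is its lowest
    degree in the coinvariant algebra. *)
Lemma fake_degreeP (k : 'I_10) e : is_fake_degree V (rho k) e = (e == nth 0%N fake_degrees k).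
Proof.
set b := nth _ _ _.
have /andP[nzb /allP lowb] := allP coinv_mults_fake _ (mem_iota10 k).
have low n : (n < b)%N -> rho k \notin irr_constt (symC V n).
  move=> ltnb; rewrite irr_consttE negbK sym_coinv_dot big1 // => j _.
  rewrite cfdot_coinv (eqP (lowb _ _)) ?mulr0 //.
  by rewrite mem_iota (leq_ltn_trans _ ltnb) // -ltnS.
have inb : rho k \in irr_constt (symC V b).
  rewrite irr_consttE sym_coinv_dot big_ord_recr /= subnn big1 ?add0r => [|j _].
    have := inv_dim_series genW relW geomV 0; rewrite big_ord1 mul1r => ->.
    rewrite mul1r cfdot_coinv; apply: contra nzb => /eqP.
    by rewrite -zc0 => /zc_inj->.
  by rewrite cfdot_coinv (eqP (lowb _ _)) ?mulr0 // mem_iota /= ltn_ord.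
apply/andP/eqP=> [[ine /forallP Hl] | ->]; last first.
  by split=> //; apply/forallP=> j; apply: low; exact: ltn_ord.
apply/eqP; rewrite eqn_leq; apply/andP; split.
  by rewrite leqNgt; apply/negP=> ltbe; have := Hl (Ordinal ltbe); rewrite inb.
by rewrite leqNgt; apply/negP=> /low; rewrite ine.
Qed.

(** Degree and fake degree together separate the ten characters. *)
Lemma phi_rho (k : 'I_10) : phi V (nth 0%N dims k) (nth 0%N fake_degrees k) = rho k.
Proof.
rewrite /phi; case: pickP => [i | /(_ (rho k))]; last first.
  by rewrite rho_degree fake_degreeP !eqxx.
have [j ->] := rho_onto i; rewrite rho_degree fake_degreeP eqr_nat /= => /andP[/eqP ed /eqP eb].
congr rho; apply/val_inj.
by case: k j ed eb => -[|[|[|[|[|[|[|[|[|[|k]]]]]]]]]] Hk [[|[|[|[|[|[|[|[|[|[|j]]]]]]]]]] Hj].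
Qed.

Lemma H3_orderE : H3_order V = map rho (enum 'I_10).
Proof.
rewrite !enum_ordSl enum_ord0 /= /H3_order.
by congr [:: _; _; _; _; _; _; _; _; _; _]; rewrite -phi_rho.
Qed.

Lemma gep_rho (j k : 'I_10) : gep (H3_order V) (rho j) (rho k) = (j <= k)%N.
Proof. by rewrite /gep H3_orderE !(index_map rho_inj) !index_enum_ord. Qed.

Lemma refl_rho (k : 'I_10) : k = 1%N :> nat -> cfRepr V = 'chi_(rho k).
Proof.
move=> k1; have Tk := rhoP k; rewrite k1 in Tk.
exact: (has_table_inj genW relW (has_table_refl genW geomV) Tk).
Qed.

End Irr.

(** * Green functions and q-Kreweras numbers *)

(** The row z, column x entry is the multiplicity of the character x in Q_z, the
    characters being numbered in decreasing order; rows stop at the diagonal. *)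
Definition green_table : seq (seq (seq Z)) :=
  [:: [:: [:: 1]];
      [:: [:: 1]; [:: 0; 1]];
      [:: [:: 1]; [:: 0; 1]; [:: 0; 0; 1]];
      [:: [:: 1]; [:: 0; 1]; [:: 0; 0; 1]; [:: 0; 0; 0; 1]];
      [:: [:: 1]; [:: 0; 1]; [:: 0; 0; 1]; [::]; [:: 0; 0; 0; 1]];
      [:: [:: 1]; [:: 0; 1]; [:: 0; 0; 1]; [:: 0; 0; 0; 1]; [:: 0; 0; 0; 1]; [:: 0; 0; 0; 0;
          1]];
      [:: [:: 1]; [:: 0; 1]; [:: 0; 0; 1; 0; 1]; [:: 0; 0; 0; 1]; [:: 0; 0; 0; 1]; [:: 0; 0;
          0; 0; 1]; [:: 0; 0; 0; 0; 0; 1]];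
      [:: [:: 1]; [:: 0; 1; 0; 0; 0; 1]; [:: 0; 0; 1; 0; 1]; [:: 0; 0; 0; 1]; [:: 0; 0; 0;
          1]; [:: 0; 0; 0; 0; 1]; [:: 0; 0; 0; 0; 0; 1]; [:: 0; 0; 0; 0; 0; 0; 1]];
      [:: [:: 1]; [:: 0; 1; 0; 0; 0; 1]; [:: 0; 0; 1; 0; 1; 0; 1]; [:: 0; 0; 0; 1; 0; 0; 0;
          1]; [:: 0; 0; 0; 1; 0; 1]; [:: 0; 0; 0; 0; 1; 0; 1]; [:: 0; 0; 0; 0; 0; 1; 0; 1];
          [:: 0; 0; 0; 0; 0; 0; 1]; [:: 0; 0; 0; 0; 0; 0; 0; 0; 1]];
      [:: [:: 1]; [:: 0; 1; 0; 0; 0; 1; 0; 0; 0; 1]; [:: 0; 0; 1; 0; 1; 0; 1; 0; 1; 0; 1];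
          [:: 0; 0; 0; 1; 0; 0; 0; 1; 0; 1; 0; 1]; [:: 0; 0; 0; 1; 0; 1; 0; 1]; [:: 0; 0; 0;
          0; 1; 0; 1; 0; 1; 0; 0; 0; 1]; [:: 0; 0; 0; 0; 0; 1; 0; 1; 0; 1; 0; 1; 0; 1];
          [:: 0; 0; 0; 0; 0; 0; 1; 0; 0; 0; 1; 0; 0; 0; 1]; [:: 0; 0; 0; 0; 0; 0; 0; 0; 1; 0;
          1; 0; 1]; [:: 0; 0; 0; 0; 0; 0; 0; 0; 0; 0; 0; 0; 0; 0; 0; 1]]]%coqZ.

(** The coefficients lambda of the Lusztig-Shoji algorithm. *)
Definition lambda_table : seq (seq Z) :=
  [:: [:: 0; 0; 0; 0; 0; 0; 0; 0; 0; 0; 0; 0; -1; 0; 1; 0; 0; 0; 1; 0; -1; 0; 1; 0; -1; 0; 0;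
          0; -1; 0; 1];
      [:: 0; 0; 0; 0; 0; 0; 0; 0; 0; 0; -1; 0; 1; 0; 0; 0; 1; 0; -1; 0; 1; 0; -1; 0; 0; 0;
          -1; 0; 1];
      [:: 0; 0; 0; 0; 0; 0; 0; 0; -1; 0; 1; 0; 0; 0; 1; 0; -1; 0; 1; 0; -1; 0; 0; 0; -1; 0; 1];
      [:: 0; 0; 0; 0; 0; 0; -1; 0; 1; 0; 0; 0; 1; 0; -1; 0; 1; 0; -1; 0; 0; 0; -1; 0; 1];
      [:: 0; 0; 0; 0; 0; 0; 0; 0; 1; 0; 0; 0; 0; 0; -1; 0; 0; 0; -1; 0; 0; 0; 0; 0; 1];
      [:: 0; 0; 0; 0; 0; 0; 1; 0; 0; 0; 0; 0; -1; 0; 0; 0; -1; 0; 0; 0; 0; 0; 1];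
      [:: 0; 0; 0; 0; 1; 0; 0; 0; 0; 0; -1; 0; 0; 0; -1; 0; 0; 0; 0; 0; 1];
      [:: 0; 0; 1; 0; 0; 0; 0; 0; -1; 0; 0; 0; -1; 0; 0; 0; 0; 0; 1];
      [:: -1; 0; -1; 0; -1; 0; 0; 0; 0; 0; 1; 0; 1; 0; 1];
      [:: 1]]%coqZ.

Definition green z x : seq Z := nth [::] (nth [::] green_table z) x.

Lemma green_gram : all (fun x => all (fun y =>
  lz_eq (lz_mul (lz_mono 15) (nth [::] (nth [::] omega x) y))
        (lz_sum [seq lz_mul (lz_mul (nth [::] lambda_table z) (green z x)) (green z y)
                | z <- iota 0 10])) (iota 0 10)) (iota 0 10).
Proof. by vm_compute. Qed.

Lemma green_triangular : all (fun z =>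
  lz_eq (green z z) (lz_mono (nth 0%N fake_degrees z))
  && all (fun x => (x <= z)%N || (green z x == [::])) (iota 0 10)) (iota 0 10).
Proof. by vm_compute. Qed.

(** The polynomial 1 - q ^ d. *)
Definition lz_factor d : seq Z := lz_add [:: 1%coqZ] (lz_scale (-1)%coqZ (lz_mono d)).

(** With T = q ^ t, the coefficient Krew of the character x is
    krew_cofactor x * R (T) / (q ^ 15 (1 - q ^ 2) (1 - q ^ 6) (1 - q ^ 10)), where
    R, given by [krew_T], is T ^ 3, T ^ 2 (T - q), T (T - q) (T - q ^ 5) or
    (T - q) (T - q ^ 5) (T - q ^ 9). *)
Definition krew_cofactor x : seq Z :=
  let m (n : nat) l := lz_mul (lz_mono n) l in
  let f := lz_mul (lz_factor 6) (lz_factor 10) in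
  let g := lz_scale (-1)%coqZ f in
  let h := lz_mul (lz_factor 2) f in
  nth [::]
    [:: m 12%N h; m 10%N h; m 8%N h; m 6%N h; m 8%N g; m 6%N g; m 4%N g; m 2%N g;
        lz_mul (lz_add [:: 1%coqZ] (lz_add (lz_mono 2) (lz_mono 4))) (lz_factor 10);
        [:: (-1)%coqZ]] x.

(** Coefficients of T ^ 0, ..., T ^ 3 in the cubic with d factors T - q ^ i. *)
Definition krew_T d : seq (seq Z) :=
  let one := [:: 1%coqZ] in
  let neg l := lz_scale (-1)%coqZ l in
  nth [::]
   [:: [:: [::]; [::]; [::]; one];
       [:: [::]; [::]; neg (lz_mono 1); one];
       [:: [::]; lz_mono 6; neg (lz_add (lz_mono 1) (lz_mono 5)); one];
       [:: neg (lz_mono 15); lz_add (lz_mono 6) (lz_add (lz_mono 10) (lz_mono 14));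
           neg (lz_add (lz_mono 1) (lz_add (lz_mono 5) (lz_mono 9))); one]] d.

Definition krew_T_degree x : nat := nth 0%N [:: 0; 1; 1; 1; 1; 1; 1; 2; 2; 3]%N x.
Definition krew_coef x j : seq Z :=
  lz_mul (krew_cofactor x) (nth [::] (krew_T (krew_T_degree x)) j).

(** The system defining the coefficients Krew, cleared of denominators and compared
    coefficientwise in T. *)
Lemma krew_check : all (fun y => all (fun j =>
  lz_eq (lz_sum [seq lz_mul (krew_coef x j) (green x y) | x <- iota 0 10])
        (lz_scale (if odd j then -1 else 1)%coqZ
           (lz_mul (lz_mono 15) (nth [::] (nth [::] coinv_ext_mults j) y))))
  (iota 0 4)) (iota 0 10).
Proof. by vm_compute. Qed.

Lemma degrees_polyE : lq degrees_poly = (1 - q ^+ 2) * (1 - q ^+ 6) * (1 - q ^+ 10).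
Proof.
have -> : lq degrees_poly =
    lq (lz_mul (lz_mul (lz_factor 2) (lz_factor 6)) (lz_factor 10)) by exact: lq_eq.
by rewrite !(lq_mul, lq_add, lq_scale, lq_mono, lq_cons, lq_nil) mulr0 addr0 !mulN1r.
Qed.

Lemma degrees_poly_neq0 : lq degrees_poly != 0.
Proof.
by rewrite degrees_polyE !mulf_neq0 // -opprB oppr_eq0 q_exp_neq1.
Qed.

Definition krew (T : Qq) x : Qq :=
  lq (krew_cofactor x) * (\sum_(j < 4) T ^+ j * lq (nth [::] (krew_T (krew_T_degree x)) j))
  / (q ^+ 15 * lq degrees_poly).

Lemma big_iota10 (f : nat -> Qq) : \sum_(z <- iota 0 10) f z = \sum_(z < 10) f z.
Proof. by rewrite -(big_mkord xpredT f) /index_iota. Qed.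

Lemma field_cancel (K : fieldType) (a b c u v : K) : v != 0 ->
  a * (b * (c * u)) = b * a * (u / v) * (c * v).
Proof. by move=> nzv; field. Qed.

(** The coefficients are summed over the powers of T first, so that each power is
    an instance of [krew_check]. *)
Lemma krew_expand T (y : 'I_10) :
  \sum_(x < 10) krew T x * lq (green x y) =
  \sum_(j < 4) (- T) ^+ j *
     (lq (nth [::] (nth [::] coinv_ext_mults j) y) / lq degrees_poly).
Proof.
have nzd : q ^+ 15 * lq degrees_poly != 0.
  exact: mulf_neq0 (expf_neq0 _ q_neq0) degrees_poly_neq0.
apply: (mulIf nzd); rewrite !mulr_suml.
transitivity (\sum_(j < 4) T ^+ j *
   (\sum_(x < 10) lq (krew_coef x j) * lq (green x y))).
  under [RHS]eq_bigr => j _ do rewrite mulr_sumr.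
  rewrite exchange_big /=; apply: eq_bigr => x _.
  rewrite /krew mulrAC divfK // mulr_sumr mulr_suml; apply: eq_bigr => j _.
  by rewrite /krew_coef lq_mul; ring.
apply: eq_bigr => j _.
have jm : val j \in iota 0 4 by rewrite mem_iota; exact: ltn_ord.
have := lq_eq (allP (allP krew_check _ (mem_iota10 y)) _ jm).
rewrite lq_sum big_map big_iota10 lq_scale lq_mul lq_mono => e.
under eq_bigr => x _ do rewrite -lq_mul.
rewrite e exprNn (_ : _%:~R = (-1) ^+ j); last by rewrite -signr_odd; case: odd.
exact: field_cancel degrees_poly_neq0.
Qed.

Section Main.

Variables (gT : finGroupType) (W : {group gT}) (s : 'I_3 -> gT).
Hypothesis genW : W :=: <<[set s i | i : 'I_3]>>%g.
Hypothesis relW : forall i j, ((s i * s j) ^+ H3_matrix i j = 1)%g.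
Variable V : mx_representation algC W 3.
Hypothesis geomV : geometric_repr H3_matrix s V.
Variable rho : 'I_10 -> Iirr W.
Hypothesis rhoP : forall k, has_table s 'chi_(rho k) (chi_tab k).

Lemma big_rho (f : Iirr W -> Qq) : \sum_z f z = \sum_(k < 10) f (rho k).
Proof.
have [g gK] := fin_all_exists (rho_onto genW relW geomV rhoP).
apply: reindex; apply: onW_bij; exists g => [k|z]; last by rewrite -gK.
by apply: (rho_inj genW relW geomV rhoP); rewrite -gK.
Qed.

Variables (Q : Iirr W -> Kq W) (lambda : Iirr W -> Qq).
Hypothesis HQ : lusztig_shoji V (H3_order V) 15 Q lambda.

Lemma green_tri :
  triangular (fun z : 'I_10 => q ^+ nth 0%N fake_degrees z) (fun z x : 'I_10 => lq (green z x)).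
Proof.
split=> [z | z x lt_zx].
  by have /andP[/lq_eq-> _] := allP green_triangular _ (mem_iota10 z); rewrite lq_mono.
have /andP[_ /allP/(_ _ (mem_iota10 x))] := allP green_triangular _ (mem_iota10 z).
by rewrite leqNgt lt_zx /= => /eqP->; exact: lq_nil.
Qed.

Lemma q_exp_neq0 n : q ^+ n != 0.
Proof. by rewrite expf_neq0 // q_neq0. Qed.

(** Both matrices solve the same equations, so [gram_unique] identifies them. *)
Lemma greenE (z x : 'I_10) : Q (rho z) (rho x) = lq (green z x).
Proof.
have [nz_l Qd Qt Qo] := HQ.
have tri : triangular (fun z : 'I_10 => q ^+ nth 0%N fake_degrees z)
                         (fun z x : 'I_10 => Q (rho z) (rho x)).
  split=> [k | k j lt_kj].
    rewrite -pairing_chi; apply: Qd.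
    by rewrite (fake_degreeP genW relW geomV rhoP).
  by rewrite -pairing_chi Qt // (gep_rho genW relW geomV rhoP) -ltnNge.
have [] := @gram_unique _ _ _ (fun k => q_exp_neq0 _) _ _
  (fun k : 'I_10 => lambda (rho k)) (fun k : 'I_10 => lq (nth [::] lambda_table k))
  tri green_tri (fun k => nz_l _) _ z.
  move=> j k; have := Qo (rho j) (rho k); rewrite pairing_chi.
  rewrite (gclass_omega genW relW geomV rhoP) big_rho.
  under eq_bigr => i _ do rewrite !pairing_chi.
  move=> <-; have := lq_eq (allP (allP green_gram _ (mem_iota10 j)) _ (mem_iota10 k)).
  rewrite lq_mul lq_mono => ->; rewrite lq_sum big_map big_iota10.
  by apply: eq_bigr => i _; rewrite !lq_mul.
by move=> _; exact.
Qed.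

Lemma pairing_refl (z : 'I_10) : pairing (Q (rho z)) (kclass (cfRepr V)) = lq (green z 1).
Proof.
have lt1 : (1 < 10)%N by [].
rewrite (refl_rho genW relW geomV rhoP (k := Ordinal lt1)) //.
by rewrite pairing_chi greenE.
Qed.

Variables (t : nat) (Krew : Iirr W -> Qq).
Hypothesis HK : q_kreweras V Q t Krew.

Lemma krewE (z : 'I_10) : Krew (rho z) = krew (q ^+ t) z.
Proof.
apply: (@triangular_solve _ _ _ (fun k => q_exp_neq0 _) _ (fun k => Krew (rho k))
  (fun k => krew (q ^+ t) k) green_tri) => y.
have := congr1 (fun h : Kq W => h (rho y)) HK; rewrite /Ht !sum_ffunE big_rho => E.
transitivity (\sum_(k < 10) (Krew (rho k) *: Q (rho k)) (rho y)).
  by apply: eq_bigr => k _; rewrite ffunE greenE.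
rewrite -E krew_expand; apply: eq_bigr => j _.
by rewrite ffunE (gclass_sym_ext genW relW geomV rhoP).
Qed.

End Main.

Lemma lq1 : lq [:: 1%coqZ] = 1. Proof. by rewrite lq_cons lq_nil mulr0 addr0. Qed.
Lemma lq_opp p : lq (lz_scale (-1)%coqZ p) = - lq p.
Proof. by rewrite lq_scale mulN1r. Qed.
Lemma lqN1 : lq [:: (-1)%coqZ] = - 1.
Proof. by rewrite lq_cons lq_nil mulr0 addr0. Qed.
Lemma lq_factor d : lq (lz_factor d) = 1 - q ^+ d.
Proof. by rewrite lq_add lq_opp lq1 lq_mono. Qed.

Lemma krew_sum T x (l := krew_T (krew_T_degree x)) : krew T x =
  lq (krew_cofactor x) *
  (lq (nth [::] l 0) + T * lq (nth [::] l 1) + T ^+ 2 * lq (nth [::] l 2) + T ^+ 3 * lq (nth [::] l 3))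
  / (q ^+ 15 * ((1 - q ^+ 2) * (1 - q ^+ 6) * (1 - q ^+ 10))).
Proof.
rewrite /krew degrees_polyE -/l; congr (_ * _ / _).
by rewrite !big_ord_recl big_ord0 addr0 expr0 expr1 mul1r !addrA.
Qed.

Section Formulas.

Variables (K : fieldType) (a T : K).
Hypotheses (nz0 : a != 0) (nz1 : a - 1 != 0) (nz2 : a ^+ 2 - 1 != 0).
Hypotheses (nz6 : a ^+ 6 - 1 != 0) (nz10 : a ^+ 10 - 1 != 0).

(** The q-integer [n]. *)
Definition fr n : K := (a ^+ n - 1) / (a - 1).
(** The q-integer [t - n], where T = q ^ t. *)
Definition ft n : K := (T / a ^+ n - 1) / (a - 1).
Definition den : K := a ^+ 15 * ((1 - a ^+ 2) * (1 - a ^+ 6) * (1 - a ^+ 10)).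
(** The cubics of [krew_T], in the unsimplified form that evaluation of lists
    yields. *)
Definition tp0 : K := 0 + T * 0 + T ^+ 2 * 0 + T ^+ 3 * 1.
Definition tp1 : K := 0 + T * 0 + T ^+ 2 * (- a ^+ 1) + T ^+ 3 * 1.
Definition tp2 : K := 0 + T * a ^+ 6 + T ^+ 2 * (- (a ^+ 1 + a ^+ 5)) + T ^+ 3 * 1.
Definition tp3 : K := - a ^+ 15 + T * (a ^+ 6 + (a ^+ 10 + a ^+ 14))
  + T ^+ 2 * (- (a ^+ 1 + (a ^+ 5 + a ^+ 9))) + T ^+ 3 * 1.
Definition cf : K := (1 - a ^+ 6) * (1 - a ^+ 10).
Definition cd : K := (1 - a ^+ 2) * cf.

Let tp1E : tp1 = T ^+ 2 * (T - a). Proof. by rewrite /tp1; ring. Qed.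
Let tp2E : tp2 = T * (T - a) * (T - a ^+ 5). Proof. by rewrite /tp2; ring. Qed.
Let tp3E : tp3 = (T - a) * (T - a ^+ 5) * (T - a ^+ 9). Proof. by rewrite /tp3; ring. Qed.
Let n2 : 1 - a ^+ 2 != 0. Proof. by rewrite -opprB oppr_eq0. Qed.
Let n6 : 1 - a ^+ 6 != 0. Proof. by rewrite -opprB oppr_eq0. Qed.
Let n10 : 1 - a ^+ 10 != 0. Proof. by rewrite -opprB oppr_eq0. Qed.

Lemma krew_formula_15 : - 1 * tp3 / den = ft 1 * ft 5 * ft 9 / (fr 2 * fr 6 * fr 10).
Proof. by rewrite tp3E /den /ft /fr; field; rewrite ?nz0 ?nz1 ?nz2 ?nz6 ?nz10 ?n2 ?n6 ?n10. Qed.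
Lemma krew_formula_0 : a ^+ 12 * cd * tp0 / den = T ^+ 3 / a ^+ 3.
Proof. by rewrite /tp0 /cd /cf /den; field; rewrite ?nz0 ?n2 ?n6 ?n10. Qed.
(** The coefficients with a factor [t - 1] / [2]. *)
Lemma krew_formula_half m k : (m + k = 14)%N ->
  a ^+ m * (- cf) * tp1 / den = T ^+ 2 / a ^+ k * (ft 1 / fr 2).
Proof.
move=> mk; have -> : a ^+ m = a ^+ 14 / a ^+ k.
  by rewrite -mk exprD mulfK // expf_neq0.
have nzk : a ^+ k != 0 by rewrite expf_neq0.
move: (a ^+ k) nzk => b nzb.
by rewrite tp1E /den /cf /ft /fr; field; rewrite ?nz0 ?nz1 ?nz2 ?nzb ?n2 ?n6 ?n10.
Qed.
(** The coefficients with a factor (q - 1) [t - 1]. *)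
Lemma krew_formula_plain m k : (m + k = 14)%N ->
  a ^+ m * cd * tp1 / den = T ^+ 2 / a ^+ k * (a - 1) * ft 1.
Proof.
move=> mk; have -> : a ^+ m = a ^+ 14 / a ^+ k.
  by rewrite -mk exprD mulfK // expf_neq0.
have nzk : a ^+ k != 0 by rewrite expf_neq0.
move: (a ^+ k) nzk => b nzb.
by rewrite tp1E /den /cd /cf /ft; field; rewrite ?nz0 ?nz1 ?nzb ?n2 ?n6 ?n10.
Qed.
Lemma krew_formula_6 : a ^+ 2 * (- cf) * tp2 / den =
  T / a ^+ 7 * (a - 1) * (ft 1 * ft 5 / fr 2).
Proof. by rewrite tp2E /den /cf /ft /fr; field; rewrite ?nz0 ?nz1 ?nz2 ?n2 ?n6 ?n10. Qed.
Lemma krew_formula_8 : (1 + (a ^+ 2 + a ^+ 4)) * (1 - a ^+ 10) * tp2 / den =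
  T / a ^+ 9 * (ft 1 * ft 5 / fr 2 ^+ 2).
Proof. by rewrite tp2E /den /ft /fr; field; rewrite ?nz0 ?nz1 ?nz2 ?n2 ?n6 ?n10. Qed.

End Formulas.

Lemma q_expz1 (t b : nat) : q ^ (t%:Z - b%:Z) = q ^+ t / q ^+ b.
Proof. by have := q_expz t 1 b; rewrite mul1r expr1. Qed.

Lemma qint_sub (t k : nat) : qint (t%:Z - k%:Z) = ft q (q ^+ t) k.
Proof. by rewrite /qint q_expz1. Qed.

Lemma q_sub1_neq0 : q - 1 != 0.
Proof. exact: (@q_exp_neq1 1). Qed.

(** Evaluates the lists of [krew_cofactor] and [krew_T] without unfolding their
    entries. *)
Ltac expand_krew := rewrite krew_sum;
  cbv beta iota zeta delta [krew_cofactor krew_T krew_T_degree nth nat_of_ord];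
  rewrite ?(lq_opp, lq_mul) ?lq_factor ?(lq1, lqN1, lq_nil, lq_add, lq_mono).

Theorem mainTheorem6
    (gT : finGroupType) (W : {group gT}) (s : 'I_3 -> gT)
    (HW : coxeter_system H3_matrix W s)
    (V : mx_representation algC W 3) (HV : geometric_repr H3_matrix s V)
    (Q : Iirr W -> Kq W) (lambda : Iirr W -> Qq)
    (HQ : lusztig_shoji V (H3_order V) 15 Q lambda)
    (t : nat) (ht : (0 < t)%N)
    (Krew : Iirr W -> Qq) (HK : q_kreweras V Q t Krew) :
  let T : int := t%:Z in
  let QV (x : Iirr W) : Qq := pairing (Q x) (kclass (cfRepr V)) in
  (Krew (phi V 1 15)
     = qint (T - 1) * qint (T - 5) * qint (T - 9)
       / (qint 2 * qint 6 * qint 10)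
   /\ QV (phi V 1 15) = q ^+ 9 + q ^+ 5 + q) /\
  (Krew (phi V 1 0) = q ^ (3 * T - 3)
   /\ QV (phi V 1 0) = 0) /\
  (Krew (phi V 5 5) = q ^ (2 * T - 10) * (qint (T - 1) / qint 2)
   /\ QV (phi V 5 5) = q) /\
  (Krew (phi V 5 2) = q ^ (2 * T - 6) * (q - 1) * qint (T - 1)
   /\ QV (phi V 5 2) = q) /\
  (Krew (phi V 3 6)
     = q ^ (T - 7) * (q - 1) * (qint (T - 1) * qint (T - 5) / qint 2)
   /\ QV (phi V 3 6) = q ^+ 5 + q) /\
  (Krew (phi V 3 8)
     = q ^ (T - 9) * (qint (T - 1) * qint (T - 5) / qint 2 ^+ 2)
   /\ QV (phi V 3 8) = q ^+ 5 + q) /\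
  (Krew (phi V 3 1) = q ^ (2 * T - 4) * (q - 1) * qint (T - 1)
   /\ QV (phi V 3 1) = q) /\
  (Krew (phi V 3 3) = q ^ (2 * T - 6) * (qint (T - 1) / qint 2)
   /\ QV (phi V 3 3) = q) /\
  (Krew (phi V 4 3) = q ^ (2 * T - 8) * (q - 1) * qint (T - 1)
   /\ QV (phi V 4 3) = q) /\
  (Krew (phi V 4 4) = q ^ (2 * T - 8) * (qint (T - 1) / qint 2)
   /\ QV (phi V 4 4) = q).
Proof.
have [genW relW _] := HW; have [rho rhoP] := fin_all_exists (irr_table genW relW HV).
move=> T QV.
have phiE k (h : (k < 10)%N) :
    phi V (nth 0%N dims k) (nth 0%N fake_degrees k) = rho (Ordinal h).
  exact: (phi_rho genW relW HV rhoP (Ordinal h)).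
have KE := krewE genW relW HV rhoP HQ HK.
have QVE (z : 'I_10) p : lz_eq (green z 1) p -> QV (rho z) = lq p.
  by move/lq_eq <-; exact: (pairing_refl genW relW HV rhoP HQ).
have QVq (z : 'I_10) : lz_eq (green z 1) (lz_mono 1) -> QV (rho z) = q.
  by move/QVE->; rewrite lq_mono.
have QVq5 (z : 'I_10) : lz_eq (green z 1) (lz_add (lz_mono 5) (lz_mono 1)) ->
    QV (rho z) = q ^+ 5 + q.
  by move/QVE->; rewrite lq_add !lq_mono.
have e1 : qint (T - 1) = ft q (q ^+ t) 1 := qint_sub t 1.
have e5 : qint (T - 5) = ft q (q ^+ t) 5 := qint_sub t 5.
have e9 : qint (T - 9) = ft q (q ^+ t) 9 := qint_sub t 9.
have n1 := q_sub1_neq0; have n2 := @q_exp_neq1 2 isT.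
have n6 := @q_exp_neq1 6 isT; have n10 := @q_exp_neq1 10 isT.
have x2 b : q ^ (2 * T - b%:Z) = (q ^+ t) ^+ 2 / q ^+ b := q_expz t 2 b.
have [E9 E0] := (phiE 9 isT, phiE 0%N isT).
have [E6 E2] := (phiE 6 isT, phiE 2 isT).
have [E7 E8] := (phiE 7 isT, phiE 8 isT).
have [E1 E4] := (phiE 1%N isT, phiE 4 isT).
have [E3 E5] := (phiE 3 isT, phiE 5 isT).
rewrite /= in E0 E1 E2 E3 E4 E5 E6 E7 E8 E9.
rewrite e1 e5 e9 E0 E1 E2 E3 E4 E5 E6 E7 E8 E9 !KE.
have x10 : q ^ (2 * T - 10) = (q ^+ t) ^+ 2 / q ^+ 10 := x2 10.
have x8 : q ^ (2 * T - 8) = (q ^+ t) ^+ 2 / q ^+ 8 := x2 8.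
have x6 : q ^ (2 * T - 6) = (q ^+ t) ^+ 2 / q ^+ 6 := x2 6.
have x4 : q ^ (2 * T - 4) = (q ^+ t) ^+ 2 / q ^+ 4 := x2 4.
have x3 : q ^ (3 * T - 3) = (q ^+ t) ^+ 3 / q ^+ 3 := q_expz t 3 3.
have x7 : q ^ (T - 7) = q ^+ t / q ^+ 7 := q_expz1 t 7.
have x9 : q ^ (T - 9) = q ^+ t / q ^+ 9 := q_expz1 t 9.
rewrite x10 x8 x6 x4 x3 x7 x9.
have nz := q_neq0.
have f2 : qint 2 = fr q 2 by rewrite /qint -exprnP.
have f6 : qint 6 = fr q 6 by rewrite /qint -exprnP.
have f10 : qint 10 = fr q 10 by rewrite /qint -exprnP.
rewrite f2 f6 f10.
have F15 := krew_formula_15 (q ^+ t) nz n1 n2 n6 n10.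
have F0 := krew_formula_0 (q ^+ t) nz n2 n6 n10.
have Fh m k := krew_formula_half (q ^+ t) nz n1 n2 n6 n10 (m := m) (k := k).
have Fp m k := krew_formula_plain (q ^+ t) nz n1 n2 n6 n10 (m := m) (k := k).
have F6 := krew_formula_6 (q ^+ t) nz n1 n2 n6 n10.
have F8 := krew_formula_8 (q ^+ t) nz n1 n2 n6 n10.
rewrite /den /tp3 in F15; rewrite /den /tp0 /cd /cf in F0.
rewrite /den /tp1 /cf in Fh; rewrite /den /tp1 /cd /cf in Fp.
rewrite /den /tp2 /cf in F6; rewrite /den /tp2 in F8.
do !apply: conj.
- by expand_krew; rewrite F15.
- rewrite (QVE _ (lz_add (lz_add (lz_mono 9) (lz_mono 5)) (lz_mono 1))) //.
  by rewrite !lq_add !lq_mono.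
- by expand_krew; rewrite F0.
- by rewrite (QVE _ [::]) // lq_nil.
- by expand_krew; rewrite (Fh 4 10%N erefl).
- exact: QVq.
- by expand_krew; rewrite (Fp 8 6 erefl).
- exact: QVq.
- by expand_krew; rewrite F6.
- exact: QVq5.
- by expand_krew; rewrite F8.
- exact: QVq5.
- by expand_krew; rewrite (Fp 10 4 erefl).
- exact: QVq.
- by expand_krew; rewrite (Fh 8 6 erefl).
- exact: QVq.
- by expand_krew; rewrite (Fp 6 8 erefl).
- exact: QVq.
- by expand_krew; rewrite (Fh 6 8 erefl).
exact: QVq.
Qed.
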